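(* Let $p_1,\dots,p_n\in\mathbb{R}^3$ ($n\ge 3$) be landmarks, at least three of which are non-collinear, and let $k_R,k_p,k_v>0$ and $k_1,\dots,k_n>0$. Choose the transformation set $\mathbb{Q}$ (with parameters $\theta\in(0,\pi]$ and $\mathbb{U}$) as defined in the context, and choose the constant $\delta>0$ defining $\mathcal{F}_o,\mathcal{J}_o$ such that $\delta<(1-\cos\theta)\Delta_M^*$. Consider the hybrid closed-loop system $\mathcal{H}^c_1$ with state $x^c_1=(\hat X,\tilde R,\tilde p_e,\tilde v,t)\in\mathcal{S}^c_1$ defined in the context. Then the number of discrete jumps is finite, and the set $$\mathcal{A}_1=\{(\hat X,\tilde R,\tilde p_e,\tilde v,t)\in\mathcal{S}^c_1:\ \tilde R=I_3,\ \tilde p_e=\tilde v=0_{3\times1}\}$$ is uniformly globally exponentially stable for $\mathcal{H}^c_1$.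
   Context: Notation. $SO(3)$ is the group of $3\times3$ rotation matrices. For $x\in\mathbb{R}^3$, $x^\times$ is the skew-symmetric matrix with $x^\times y=x\times y$. For $A\in\mathbb{R}^{3\times3}$, $\mathbb{P}_a(A)=(A-A^\top)/2$. For $R\in SO(3)$, $|R|_I^2=\frac14\mathrm{tr}(I_3-R)$. $\mathbb{S}^2$ is the set of unit vectors of $\mathbb{R}^3$ and $\mathcal{R}_a(\theta,u)=I_3+\sin\theta\,u^\times+(1-\cos\theta)(u^\times)^2$ for $u\in\mathbb{S}^2$. $\mathcal{T}(R,v,p)=\begin{bmatrix}R&v&p\\0_{1\times3}&1&0\\0_{1\times3}&0&1\end{bmatrix}$ and $SE_2(3)=\{\mathcal{T}(R,v,p): R\in SO(3),\,v,p\in\mathbb{R}^3\}$, a matrix Lie group. $\mathrm{Ad}_XU=XUX^{-1}$. The projection $\mathbb{P}:\mathbb{R}^{5\times5}\to\mathfrak{se}_2(3)$ is $\mathbb{P}\left(\begin{bmatrix}A_1&a_2&a_3\\ a_4^\top&a_6&a_7\\ a_5^\top&a_8&a_9\end{bmatrix}\right)=\begin{bmatrix}\mathbb{P}_a(A_1)&a_2&a_3\\0_{1\times 3}&0&0\\0_{1\times 3}&0&0\end{bmatrix}$ ($A_1\in\mathbb{R}^{3\times 3}$, $a_2,\dots,a_5\in\mathbb{R}^3$, $a_6,\dots,a_9\in\mathbb{R}$). System and measurements. The true state $X=\mathcal{T}(R,v,p)\in SE_2(3)$ satisfies $\dot R=R\omega^\times$, $\dot p=v$, $\dot v=\mathsf{g}+Ra$,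 i.e. $\dot X=f(X,\omega,a):=\begin{bmatrix}R\omega^\times&\mathsf{g}+Ra&v\\0_{1\times 3}&0&0\\0_{1\times 3}&0&0\end{bmatrix}$, where $\mathsf{g}\in\mathbb{R}^3$ is constant and $\omega,a$ are known continuous functions of time. Landmark measurements are $y_i=R^\top(p_i-p)$, $i=1,\dots,n$. Put $r_i=[p_i^\top\ 0\ 1]^\top$, $b_i=[y_i^\top\ 0\ 1]^\top=X^{-1}r_i$, $r=[r_1\cdots r_n]$, $b=[b_1\cdots b_n]\in\mathbb{R}^{5\times n}$. Let $k_c=\sum_ik_i$, $p_c=\frac1{k_c}\sum_ik_ip_i$, $M=\sum_ik_i(p_i-p_c)(p_i-p_c)^\top$, $X_c=\mathcal{T}(I_3,0_{3\times 1},p_c)$, $K_n=\mathrm{diag}(k_1,\dots,k_n)$, $K=\begin{bmatrix}k_RI_3&0_{3\times 1}&0_{3\times 1}\\0_{1\times 3}&0&0\\0_{1\times 3}&k_v&k_p\end{bmatrix}$. Errors. With the estimate $\hat X=\mathcal{T}(\hat R,\hat v,\hat p)$: $\tilde R=R\hat R^\top$, $\tilde v=v-\tilde R\hat v$, $\tilde p=p-\tilde R\hat p$, $\tilde p_e=\tilde p-(I_3-\tilde R)p_c$. Thus $X=\mathcal{T}(\tilde R,\tilde v,\tilde p)\hat X$, and quantities depending on $b=X^{-1}r$ are functions of $(\hat X,\tilde R,\tilde p_e,\tilde v)$. Flow/jump sets and jump map. $\Upsilon(\hat X,r,b)=\frac12\sum_ik_i\|(r_i-r_c)-\hat X(b_i-b_c)\|^2$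 with $r_c=\frac1{k_c}\sum_ik_ir_i$, $b_c=\frac1{k_c}\sum_ik_ib_i$ (so $\Upsilon(\hat X,r,b)=\mathrm{tr}((I_3-\tilde R)M)$). $\mu_{\mathbb{Q}}(\hat X,r,b)=\Upsilon(\hat X,r,b)-\min_{X_q\in\mathbb{Q}}\Upsilon(X_q^{-1}\hat X,r,b)$. $\mathcal{F}_o=\{\hat X\in SE_2(3):\mu_{\mathbb{Q}}(\hat X,r,b)\le\delta\}$, $\mathcal{J}_o=\{\hat X\in SE_2(3):\mu_{\mathbb{Q}}(\hat X,r,b)\ge\delta\}$. $\gamma(\hat X)=\{X_q\in\mathbb{Q}: X_q=\arg\min_{X_q\in\mathbb{Q}}\Upsilon(X_q^{-1}\hat X,r,b)\}$ (set of minimizers). Set $\mathbb{Q}$. $\mathbb{Q}=\{\mathcal{T}(R,v,p)\in SE_2(3):R=\mathcal{R}_a(\theta,u),\,u\in\mathbb{U},\,p=(I_3-R)p_c,\,v=0_{3\times 1}\}$ with constant $\theta\in(0,\pi]$ and $\mathbb{U}\subset\mathbb{S}^2$ a finite set chosen in one of two ways: (1) $\mathbb{U}$ contains an orthonormal eigenbasis $\mathbb{E}(M)$ of $M$, when the eigenvalues satisfy $\lambda_1^M\ge\lambda_2^M\ge\lambda_3^M>0$ or $\lambda_1^M>\lambda_2^M>\lambda_3^M=0$; (2) $\mathbb{U}$ contains three orthogonal unit vectors of $\mathbb{R}^3$, when $\mathrm{tr}(M)-2\lambda^M_{\max}>0$ ($\lambda_{\max}^M$ the largest eigenvalue). With $\mathcal{E}(M)$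 the set of unit eigenvectors of $M$, $\Delta_M^*=\min_{v\in\mathcal{E}(M)}\max_{u\in\mathbb{U}}u^\top(\mathrm{tr}(M_v)I_3-M_v)u$, where $M_v=M(I_3-2vv^\top)$. Closed-loop system $\mathcal{H}^c_1$. $\mathcal{S}^c_1=SE_2(3)\times SO(3)\times\mathbb{R}^3\times\mathbb{R}^3\times\mathbb{R}^+$ ($\mathbb{R}^+$ the nonnegative reals), $\mathcal{F}^c_1=\{x^c_1\in\mathcal{S}^c_1:\hat X\in\mathcal{F}_o\}$, $\mathcal{J}^c_1=\{x^c_1\in\mathcal{S}^c_1:\hat X\in\mathcal{J}_o\}$. Flow for $x^c_1\in\mathcal{F}^c_1$: $\dot{\hat X}=f(\hat X,\omega,a)-\Delta\hat X$, $\dot{\tilde R}=\tilde R(-k_R\mathbb{P}_a(M\tilde R))$, $\dot{\tilde p}_e=-k_ck_p\tilde p_e+\tilde v$, $\dot{\tilde v}=-k_ck_v\tilde p_e+(I_3-\tilde R)\mathsf{g}$, $\dot t=1$, where $\Delta=-\mathrm{Ad}_{X_c}\big(\mathbb{P}(X_c^{-1}(r-\hat Xb)K_nr^\top X_c^{-\top}K)\big)$. Jump for $x^c_1\in\mathcal{J}^c_1$: $\hat X^+=X_q^{-1}\hat X$, $\tilde R^+=\tilde RR_q$, $\tilde p_e^+=\tilde p_e$, $\tilde v^+=\tilde v$, $t^+=t$, with $X_q=\mathcal{T}(R_q,v_q,p_q)\in\gamma(\hat X)$. Solutions and stability. Solutions are hybrid arcs on hybrid time domains $\mathrm{dom}\,x\subset\mathbb{R}^+\times\mathbb{N}$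 (Goebel–Sanfelice–Teel framework). $\mathcal{A}_1$ is uniformly globally exponentially stable if there are $\kappa,\lambda>0$ such that for every initial condition each solution satisfies $|x(t,j)|_{\mathcal{A}_1}\le\kappa e^{-\lambda(t+j)}|x(0,0)|_{\mathcal{A}_1}$ for all $(t,j)\in\mathrm{dom}\,x$, where $|x^c_1|_{\mathcal{A}_1}^2=|\tilde R|_I^2+\|\tilde p_e\|^2+\|\tilde v\|^2$. *)

(* Defs.v *)
From HB Require Import structures.
From mathcomp Require Import all_boot all_order all_algebra.
From mathcomp Require Import all_classical all_reals all_analysis.

Set Implicit Arguments.
Unset Strict Implicit.
Unset Printing Implicit Defensive.

Import Order.TTheory GRing.Theory Num.Theory.
Import numFieldNormedType.Exports.

Local Open Scope classical_set_scope.
Local Open Scope ring_scope.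

(* Time domains, arcs and solutions are those of Goebel, Sanfelice and Teel; the
   flow map is single-valued, the jump map set-valued. *)

Record hybrid_system (V : Type) := HybridSystem {
  flow_set : set V;
  flow_map : V -> V;
  jump_set : set V;
  jump_map : V -> set V }.

Section Hybrid.
Context {R : realType}.

Definition compact_hybrid_time_domain (E : set (R * nat)) : Prop :=
  exists (J : nat) (s : nat -> R),
    [/\ s 0%N = 0,
        (forall j, (j <= J)%N -> s j <= s j.+1) &
        E = [set tj | (tj.2 <= J)%N /\ s tj.2 <= tj.1 <= s tj.2.+1]].

Definition hybrid_time_domain (E : set (R * nat)) : Prop :=
  [/\ E `<=` [set tj | 0 <= tj.1], E (0, 0%N) &
      forall T J, E (T, J) ->
        compact_hybrid_time_domain
          (E `&` [set tj | 0 <= tj.1 <= T /\ (tj.2 <= J)%N])].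

Definition time_slice (E : set (R * nat)) (j : nat) : set R :=
  [set t | E (t, j)].

Definition jump_times (E : set (R * nat)) : set (R * nat) :=
  [set tj | E tj /\ E (tj.1, tj.2.+1)].

Definition absolutely_continuous {V : normedModType R} (a b : R) (f : R -> V)
    : Prop :=
  forall e : R, 0 < e -> exists2 d : R, 0 < d &
    forall (m : nat) (l r : 'I_m -> R),
      (forall i, a <= l i /\ l i <= r i /\ r i <= b) ->
      trivIset setT (fun i => `]l i, r i[%classic) ->
      \sum_i (r i - l i) < d ->
      \sum_i `|f (r i) - f (l i)| < e.

Definition locally_absolutely_continuous {V : normedModType R} (I : set R)
    (f : R -> V) : Prop :=
  forall a b : R, a <= b -> `[a, b]%classic `<=` I ->
    absolutely_continuous a b f.

(* An arc is a total function together with its domain [E]; its values outside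
   [E] are irrelevant. *)
Definition hybrid_arc {V : normedModType R} (E : set (R * nat))
    (x : R -> nat -> V) : Prop :=
  hybrid_time_domain E /\
  forall j, locally_absolutely_continuous (time_slice E j) (x^~ j).

(* Differentiability is only required in the interior of the j-th slice: a slice
   is an interval, so that its endpoints form a null set. *)
Definition solution {V : normedModType R} (H : hybrid_system V)
    (E : set (R * nat)) (x : R -> nat -> V) : Prop :=
  [/\ hybrid_arc E x,
      (closure (flow_set H) `|` jump_set H) (x 0 0%N),
      (forall j t, interior (time_slice E j) t -> flow_set H (x t j)),
      (forall j, {ae @lebesgue_measure R, forall t,
         interior (time_slice E j) t ->
         is_derive (t : R) 1 (x^~ j) (flow_map H (x t j))}) &
      (forall t j, E (t, j) -> E (t, j.+1) ->
         jump_set H (x t j) /\ jump_map H (x t j) (x t j.+1))].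

(* [dist] plays the role of the distance to [A]. It need not come from a metric
   on the state space, so the first conjunct ties it to [A]. *)
Definition uniformly_globally_exponentially_stable {V : normedModType R}
    (H : hybrid_system V) (A : set V) (dist : V -> R) : Prop :=
  (forall x, (flow_set H `|` jump_set H) x -> dist x = 0 <-> A x) /\
  exists kappa lambda : R, [/\ 0 < kappa, 0 < lambda &
    forall E x, solution H E x -> forall t j, E (t, j) ->
      dist (x t j) <= kappa * expR (- lambda * (t + j%:R)) * dist (x 0 0%N)].

End Hybrid.

Section Geometry.
Context {R : realType}.
Implicit Types (x u v : 'cV[R]_3) (A Q M : 'M[R]_3).

Definition dot m (x y : 'cV[R]_m) : R := (x^T *m y) 0 0.

(* Squared Euclidean norm; the library's norm on matrices is the sup norm. *)
Definition sqnorm m (x : 'cV[R]_m) : R := dot x x.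

Definition skew x : 'M[R]_3 :=
  \matrix_(i, j) nth 0 (nth [::]
    [:: [::      0; - x 2 0;   x 1 0];
        [::   x 2 0;      0; - x 0 0];
        [:: - x 1 0;   x 0 0;      0]] i) j.

Definition skew_part A : 'M[R]_3 := 2^-1 *: (A - A^T).

Definition SO3 : set 'M[R]_3 := [set Q | Q *m Q^T = 1%:M /\ \det Q = 1].

Definition sqnorm_rot Q : R := 4^-1 * \tr (1%:M - Q).

Definition unit_sphere : set 'cV[R]_3 := [set u | sqnorm u = 1].

Definition angle_axis (theta : R) u : 'M[R]_3 :=
  1%:M + sin theta *: skew u + (1 - cos theta) *: (skew u *m skew u).

(* 5 x 5 matrices are typed as 'M_(3 + (1 + 1)) to expose their blocks. *)
Definition pose Q v (p : 'cV[R]_3) : 'M[R]_(3 + (1 + 1)) :=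
  block_mx Q (row_mx v p) 0 1%:M.

Definition SE23 : set 'M[R]_(3 + (1 + 1)) :=
  [set X | exists Q v p, SO3 Q /\ X = pose Q v p].

Definition se23_proj (A : 'M[R]_(3 + (1 + 1))) : 'M[R]_(3 + (1 + 1)) :=
  block_mx (skew_part (ulsubmx A)) (ursubmx A) 0 0.

Definition Ad (X U : 'M[R]_(3 + (1 + 1))) := X *m U *m invmx X.

(* X = pose Q v p is read off through Q = ulsubmx X, v = lsubmx (ursubmx X). *)
Definition navigation_field (g : 'cV[R]_3) (X : 'M[R]_(3 + (1 + 1)))
    (omega a : 'cV[R]_3) : 'M[R]_(3 + (1 + 1)) :=
  block_mx (ulsubmx X *m skew omega)
           (row_mx (g + ulsubmx X *m a) (lsubmx (ursubmx X))) 0 0.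

Definition collinear (A : set 'cV[R]_3) : Prop :=
  exists q d : 'cV[R]_3, d != 0 /\ forall x, A x -> exists s : R, x = q + s *: d.

Definition unit_eigenvectors M : set 'cV[R]_3 :=
  [set v | unit_sphere v /\ exists l : R, M *m v = l *: v].

Definition ordered_eigenvalues M (l : 'I_3 -> R) : Prop :=
  char_poly M = \prod_i ('X - (l i)%:P) /\ l 2 <= l 1 <= l 0.

Definition orthonormal_basis (e : 'I_3 -> 'cV[R]_3) : Prop :=
  forall i j, dot (e i) (e j) = (i == j)%:R.

Definition eigenbasis_axes M (U : set 'cV[R]_3) : Prop :=
  (exists2 l, ordered_eigenvalues M l &
     0 < l 2 \/ [/\ l 1 < l 0, l 2 < l 1 & l 2 = 0]) /\
  (exists e, [/\ orthonormal_basis e, (forall i, unit_eigenvectors M (e i)) &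
     forall i, U (e i)]).

Definition orthogonal_axes M (U : set 'cV[R]_3) : Prop :=
  (exists2 l, ordered_eigenvalues M l & 0 < \tr M - 2 * l 0) /\
  (exists e, orthonormal_basis e /\ forall i, U (e i)).

Definition admissible_axes M (U : set 'cV[R]_3) : Prop :=
  [/\ finite_set U, U `<=` unit_sphere &
      eigenbasis_axes M U \/ orthogonal_axes M U].

(* For a finite nonempty U and a symmetric M, the supremum and the infimum are
   a maximum and a minimum, since the unit eigenvectors form a nonempty compact
   set. *)
Definition gap M (U : set 'cV[R]_3) : R :=
  inf [set sup [set (u^T *m ((\tr (M *m (1%:M - 2 *: (v *m v^T))))%:M
                             - M *m (1%:M - 2 *: (v *m v^T))) *m u) 0 0
               | u in U]
      | v in unit_eigenvectors M].

End Geometry.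

Section Observer.
Context {R : realType} {n : nat}.
Variables (p : 'I_n -> 'cV[R]_3) (k : 'I_n -> R).

Definition k_c : R := \sum_i k i.
Definition p_c : 'cV[R]_3 := k_c^-1 *: \sum_i k i *: p i.
Definition M_c : 'M[R]_3 := \sum_i k i *: ((p i - p_c) *m (p i - p_c)^T).
Definition X_c : 'M[R]_(3 + (1 + 1)) := pose 1%:M 0 p_c.

Definition landmarks : 'M[R]_(3 + (1 + 1), n) :=
  \matrix_(i, j) col_mx (p j) (col_mx (0 : 'M[R]_1) (1%:M : 'M[R]_1)) i 0.

Definition K_n : 'M[R]_n := diag_mx (\row_i k i).

Definition gain_mx (kR kv kp : R) : 'M[R]_(3 + (1 + 1)) :=
  block_mx kR%:M 0 0 (block_mx (0 : 'M[R]_1) 0 kv%:M kp%:M).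

Definition weighted_mean (y : 'M[R]_(3 + (1 + 1), n)) : 'cV[R]_(3 + (1 + 1)) :=
  k_c^-1 *: \sum_i k i *: col i y.

Definition Upsilon (Xh : 'M[R]_(3 + (1 + 1))) (r b : 'M[R]_(3 + (1 + 1), n)) : R :=
  2^-1 * \sum_i k i * sqnorm ((col i r - weighted_mean r)
                              - Xh *m (col i b - weighted_mean b)).

Definition transformations (theta : R) (U : set 'cV[R]_3)
    : set 'M[R]_(3 + (1 + 1)) :=
  [set X | exists2 u, U u &
     X = pose (angle_axis theta u) 0 ((1%:M - angle_axis theta u) *m p_c)].

(* The infimum is a minimum when QQ is finite and nonempty. *)
Definition mu (QQ : set 'M[R]_(3 + (1 + 1))) Xh r b : R :=
  Upsilon Xh r b - inf [set Upsilon (invmx Xq *m Xh) r b | Xq in QQ].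

Definition minimizers (QQ : set 'M[R]_(3 + (1 + 1))) Xh r b
    : set 'M[R]_(3 + (1 + 1)) :=
  [set Xq | QQ Xq /\ forall Y, QQ Y ->
     Upsilon (invmx Xq *m Xh) r b <= Upsilon (invmx Y *m Xh) r b].

Definition innovation (kR kv kp : R) Xh (r b : 'M[R]_(3 + (1 + 1), n))
    : 'M[R]_(3 + (1 + 1)) :=
  - Ad X_c (se23_proj (invmx X_c *m (r - Xh *m b) *m K_n *m r^T
                       *m (invmx X_c)^T *m gain_mx kR kv kp)).

(* (estimate, rotation error, position error, velocity error, time) *)
Definition state : Type :=
  ('M[R]_(3 + (1 + 1)) * 'M[R]_3 * 'cV[R]_3 * 'cV[R]_3 * R)%type.

Definition state_space : set state :=
  [set x | let: (Xh, Rt, pe, vt, t) := x in [/\ SE23 Xh, SO3 Rt & 0 <= t]].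

(* The true pose is recovered from the estimate and the errors, with position
   error pt = pe + (I - Rt) p_c; the measurements are functions of it. *)
Definition true_pose (x : state) : 'M[R]_(3 + (1 + 1)) :=
  let: (Xh, Rt, pe, vt, t) := x in
  pose Rt vt (pe + (1%:M - Rt) *m p_c) *m Xh.

Definition measurements (x : state) : 'M[R]_(3 + (1 + 1), n) :=
  invmx (true_pose x) *m landmarks.

Definition closed_loop (kR kp kv : R) (g : 'cV[R]_3) (omega a : R -> 'cV[R]_3)
    (theta : R) (U : set 'cV[R]_3) (delta : R) : hybrid_system state :=
  let QQ := transformations theta U in
  {| flow_set := [set x | state_space x /\
       mu QQ x.1.1.1.1 landmarks (measurements x) <= delta];
     flow_map := fun x => let: (Xh, Rt, pe, vt, t) := x in
       (navigation_field g Xh (omega t) (a t)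
          - innovation kR kv kp Xh landmarks (measurements x) *m Xh,
        Rt *m (- kR *: skew_part (M_c *m Rt)),
        - (k_c * kp) *: pe + vt,
        - (k_c * kv) *: pe + (1%:M - Rt) *m g,
        1);
     jump_set := [set x | state_space x /\
       mu QQ x.1.1.1.1 landmarks (measurements x) >= delta];
     jump_map := fun x => [set y | let: (Xh, Rt, pe, vt, t) := x in
       exists Rq vq pq,
         minimizers QQ Xh landmarks (measurements x) (pose Rq vq pq) /\
         y = (invmx (pose Rq vq pq) *m Xh, Rt *m Rq, pe, vt, t)] |}.

Definition A_1 : set state :=
  [set x | state_space x /\
     let: (Xh, Rt, pe, vt, t) := x in [/\ Rt = 1%:M, pe = 0 & vt = 0]].

Definition dist_A_1 (x : state) : R :=
  let: (Xh, Rt, pe, vt, t) := x in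
  Num.sqrt (sqnorm_rot Rt + sqnorm pe + sqnorm vt).

End Observer.

Arguments state R : clear implicits.

Section DistA1.
Context {R : realType}.

Lemma sqnorm_ge0 m (x : 'cV[R]_m) : 0 <= sqnorm x.
Proof.
rewrite /sqnorm /dot mxE; apply: sumr_ge0 => i _.
by rewrite mxE -expr2 sqr_ge0.
Qed.

Lemma sqnorm_eq0 m (x : 'cV[R]_m) : sqnorm x = 0 -> x = 0.
Proof.
rewrite /sqnorm /dot mxE => x0; apply/matrixP => i j; rewrite ord1 mxE.
have h l : true -> 0 <= x^T 0 l * x l 0 by rewrite mxE -expr2 sqr_ge0.
have /eqP := @psumr_eq0P _ _ predT _ h x0 i isT.
by rewrite mxE mulf_eq0 orbb => /eqP.
Qed.

Lemma mxtrace_SO3 (Q : 'M[R]_3) : SO3 Q ->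
  \tr ((1%:M - Q) *m (1%:M - Q)^T) = 2 * \tr (1%:M - Q).
Proof.
move=> [QQT _].
have -> : (1%:M - Q) *m (1%:M - Q)^T = (1%:M - Q) + (1%:M - Q^T).
  rewrite [(1%:M - Q)^T]linearB /= trmx1 mulmxBl mul1mx mulmxBr mulmx1 QQT.
  by rewrite opprB [RHS]addrC.
rewrite linearD /= [\tr (1%:M - Q^T)]linearB [\tr (1%:M - Q)]linearB /=.
by rewrite mxtrace_tr mulrDl mul1r.
Qed.

Lemma mxtrace_mul_tr (A : 'M[R]_3) : \tr (A *m A^T) = \sum_i sqnorm (col i A).
Proof.
rewrite /mxtrace; under eq_bigr do rewrite mxE.
rewrite exchange_big; apply: eq_bigr => i _ /=; rewrite /sqnorm /dot mxE.
by apply: eq_bigr => j _; rewrite !mxE.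
Qed.

Lemma sqnorm_rot_ge0 (Q : 'M[R]_3) : SO3 Q -> 0 <= sqnorm_rot Q.
Proof.
move=> /mxtrace_SO3 h; rewrite /sqnorm_rot mulr_ge0 ?invr_ge0//.
rewrite -(@pmulr_rge0 _ 2)// -h mxtrace_mul_tr.
by apply: sumr_ge0 => i _; exact: sqnorm_ge0.
Qed.

Lemma sqnorm_rot_eq0 (Q : 'M[R]_3) : SO3 Q -> sqnorm_rot Q = 0 -> Q = 1%:M.
Proof.
move=> /mxtrace_SO3 h /eqP; rewrite /sqnorm_rot mulf_eq0 invr_eq0 pnatr_eq0 /=.
move=> /eqP tr0; move: h; rewrite tr0 mulr0 mxtrace_mul_tr => h.
have nn i : true -> 0 <= sqnorm (col i (1%:M - Q)) by move=> _; exact: sqnorm_ge0.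
apply/matrixP => i j; have := @psumr_eq0P _ _ predT _ nn h j isT.
move=> /sqnorm_eq0 /matrixP /(_ i 0); rewrite !mxE => /eqP.
by rewrite subr_eq0 eq_sym => /eqP.
Qed.

Lemma dist_A_1_eq0 (x : state R) : state_space x -> dist_A_1 x = 0 <-> A_1 x.
Proof.
case: x => [[[[Xh Rt] pe] vt] t] Sx; rewrite /A_1 /=.
have [_ SR _] := Sx.
have hR := sqnorm_rot_ge0 SR; have hp := sqnorm_ge0 pe; have hv := sqnorm_ge0 vt.
split; last first.
  move=> [_ [-> -> ->]].
  by rewrite /sqnorm_rot subrr /sqnorm /dot !mulmx0 linear0 !mxE mulr0 !addr0 sqrtr0.
move=> /eqP; rewrite sqrtr_eq0 => le0.
have /eqP : sqnorm_rot Rt + sqnorm pe + sqnorm vt = 0.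
  by apply/eqP; rewrite eq_le le0 !addr_ge0.
rewrite paddr_eq0 ?addr_ge0// paddr_eq0// => /andP[/andP[/eqP r0 /eqP p0] /eqP v0].
by split=> //; split; [exact: sqnorm_rot_eq0|exact: sqnorm_eq0..].
Qed.

End DistA1.

(* Main.v *)
(** Along the flow the rotation error [Q] obeys [Q' = - kR Q P_a(M Q)], so that
    the potential [V Q = tr((I - Q) M)] satisfies [V' = - kR |P_a(M Q)|^2].  Writing
    [Q] with a unit quaternion [(h, e)] and [W = tr(M) I - M], which is positive
    definite since three landmarks are not collinear,
      [V = 2 e.We],  [|P_a(M Q)|^2 = 2 (h^2 |We|^2 + |e x Me|^2)],
    so the only critical points other than [I] are the half-turns about unit
    eigenvectors [v] of [M].  There some [u] in [U] lowers [V] by at least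
    [(1 - cos theta) gap > delta], hence they lie outside the flow set and, by
    compactness, [|P_a(M Q)|^2 >= c |Q|_I^2] on the flow set.  Position and velocity
    errors form a stable linear system driven by [(I - Q) g]; adding a large multiple
    of [V] to a quadratic Lyapunov function of that system gives a Lyapunov function
    which decays exponentially along flows and does not grow at jumps.  Each jump
    lowers [V] by at least [delta] and [V] is bounded on SO(3), so the number of
    jumps is bounded uniformly and [exp(- lam t)] also controls [exp(- lam (t + j))].

    Solutions are only absolutely continuous and satisfy the differential equation
    almost everywhere: the passage from derivative bounds to decay is a gauge
    argument, where points of the exceptional null set are tagged by intervals inside
    an open set of small measure. *)

Require Import Defs.
From mathcomp Require Import all_boot all_order all_algebra.
From mathcomp Require Import all_classical all_reals all_analysis.
From mathcomp Require Import measurable_realfun.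
From mathcomp Require Import ring lra.

Set Implicit Arguments.
Unset Strict Implicit.
Unset Printing Implicit Defensive.

Import Order.TTheory GRing.Theory Num.Theory.
Import numFieldNormedType.Exports.
(* Otherwise [skew] denotes the notation of mathcomp's sesquilinear forms. *)
Import Defs.

Local Open Scope classical_set_scope.
Local Open Scope ring_scope.

(** * Absolutely continuous functions *)

(** Cousin's lemma, as an induction on intervals. Let [c] be the supremum of the right ends reached
    from [a]; the local hypothesis at [c], chained with a reached point just below [c], gives either
    [b] itself or a reached point beyond [c]. *)
Lemma cousin (R : realType) (P : R -> R -> Prop) (a b : R) : a <= b ->
  (forall l m r, a <= l <= m -> m <= r <= b -> P l m -> P m r -> P l r) ->
  (forall t, a <= t <= b -> exists2 d, 0 < d &
     forall l r, a <= l <= t -> t <= r <= b -> r - l < d -> P l r) ->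
  P a b.
Proof.
move=> ab Padd Ploc.
pose S := [set x | a <= x <= b /\ P a x].
have Sa : S a.
  split; first by rewrite lexx.
  have [|d d0 h] := Ploc a; first by rewrite lexx.
  by apply: h; rewrite ?subrr ?lexx.
have hS : has_sup S.
  by split; [exists a|exists b => x [/andP[]]].
pose c := sup S.
have ac : a <= c by apply: sup_upper_bound.
have cb : c <= b by apply: ge_sup => //; [exists a|move=> x [/andP[]]].
have [|d d0 h] := Ploc c; first by rewrite ac.
(* Half of [d] is spent on each side of [c], so that the interval from [x] to [y] is shorter than
   [d]. *)
have d20 : 0 < d / 2 by rewrite divr_gt0.
have [x [/andP[ax xb] Px] xc] := sup_adherent d20 hS.
rewrite -/c in xc.
have xlec : x <= c by apply: sup_upper_bound => //; split=> //; rewrite ax.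
have Pac y : c <= y <= b -> y < c + d / 2 -> P a y.
  move=> /andP[cy yb] yd; apply: (Padd a x y) => //.
  - by rewrite lexx.
  - by rewrite (le_trans xlec cy).
  - by apply: h; rewrite ?ax ?cy//; lra.
have [bd|bd] := ltP b (c + d / 2); first by apply: Pac => //; rewrite cb lexx.
have : c + d / 4 <= c.
  apply: sup_upper_bound => //; split; first by lra.
  by apply: Pac; lra.
lra.
Qed.

(** The straddle lemma: an interval around [t] is cut at [t], and on both sides the difference
    quotient is within [e] of [l], hence at most [e]. *)
Lemma is_derive_upper_slope (R : realType) (f : R -> R) (t l e : R) :
  is_derive t 1 f l -> l <= 0 -> 0 < e ->
  exists2 d, 0 < d &
    forall u v, u <= t <= v -> v - u < d -> f v - f u <= e * (v - u).
Proof.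
move=> [df <-] l0 e0.
have : (fun h : R => h^-1 *: ((f \o shift t) (h *: 1) - f t)) @ 0^' --> 'D_1 f t.
  exact: df.
move=> /cvgrPdist_lt /(_ _ e0); rewrite near_withinE => /nbhs_ballP[d /= d0 hd].
exists d => // u v /andP[ut tv] uvd.
have right : f v - f t <= e * (v - t).
  have [->|vt] := eqVneq v t; first by rewrite !subrr mulr0.
  have vt0 : 0 < v - t by rewrite subr_gt0 lt_neqAle eq_sym vt.
  have := hd (v - t); rewrite /ball/= sub0r normrN gtr0_norm//.
  move=> /(_ _ _) h.
  have {h} := h ltac:(lra) ltac:(by rewrite gt_eqF).
  rewrite ltr_norml => /andP[h _].
  have : (v - t)^-1 *: (f ((v - t) *: 1 + t) - f t) <= e by lra.
  by rewrite /GRing.scale/= mulr1 subrK ler_pdivrMl// mulrC.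
have left : f t - f u <= e * (t - u).
  have [->|ut'] := eqVneq u t; first by rewrite !subrr mulr0.
  have ut0 : u - t < 0 by rewrite subr_lt0 lt_neqAle ut'.
  have := hd (u - t); rewrite /ball/= sub0r normrN ltr0_norm//.
  move=> /(_ _ _) h.
  have {h} := h ltac:(lra) ltac:(by rewrite lt_eqF).
  rewrite ltr_norml => /andP[h _].
  have : (u - t)^-1 *: (f ((u - t) *: 1 + t) - f t) <= e by lra.
  rewrite /GRing.scale/= mulr1 subrK ler_ndivrMl//; lra.
lra.
Qed.

Lemma sum_disjoint_itv_le (R : realType) (m : nat) (l r : 'I_m -> R) (O : set R) :
  (forall i, l i <= r i) -> trivIset setT (fun i => `]l i, r i[%classic) ->
  (forall i, `]l i, r i[%classic `<=` O) -> open O ->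
  ((\sum_i (r i - l i))%:E <= lebesgue_measure O)%E.
Proof.
move=> lr tr lO oO.
have -> : ((\sum_i (r i - l i))%:E =
    \sum_(i < m) lebesgue_measure (`]l i, r i[%classic : set R))%E.
  rewrite -sumEFin; apply: eq_bigr => i _.
  rewrite lebesgue_measure_itv/= lte_fin; case: ltP => // rl.
  have -> : r i = l i by apply/eqP; rewrite eq_le rl lr.
  by rewrite subrr.
rewrite -(@measure_bigsetU_ord _ _ _ lebesgue_measure m predT) => //.
apply: le_measure; rewrite ?inE.
- by apply: bigsetU_measurable => i _; exact: measurable_itv.
- exact: open_measurable.
- by move=> x; rewrite -bigcup_seq => -[i _]; exact: lO.
Qed.

Lemma negligible_open_cover (R : realType) (N : set R) (e : R) :
  (@lebesgue_measure R).-negligible N -> 0 < e ->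
  exists O, [/\ open O, N `<=` O & (lebesgue_measure O <= e%:E)%E].
Proof.
move=> /negligible_outer_measure N0 e0.
by have [V [oO NO]] := outer_measure_open_le N e0; rewrite N0 add0e; exists V.
Qed.

(** A gauge argument. Intervals tagged outside the null set contribute at most [e] times their
    length by the straddle lemma; those tagged inside lie in an open set of measure below [d], where
    absolute continuity bounds the total contribution by [e]. *)
Lemma ac_le (R : realType) (a b : R) (f : R -> R) (N : set R) :
  a <= b -> absolutely_continuous a b f ->
  (@lebesgue_measure R).-negligible N ->
  (forall t, a < t < b -> ~ N t -> exists2 l, is_derive t 1 f l & l <= 0) ->
  f b <= f a.
Proof.
move=> ab acf N0 df.
apply/ler_addgt0Pr => e' e'0.
(* The two contributions, at most [e * (b - a)] and [e], add up to [e']. *)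
pose e := e' / (b - a + 1).
have ba1 : 0 < b - a + 1 by lra.
have e0 : 0 < e by rewrite divr_gt0.
have [d d0 hd] := acf _ e0.
(* The derivative is controlled only strictly between [a] and [b], so both ends join the exceptional
   set. *)
pose N' := N `|` [set a] `|` [set b].
have N'0 : (@lebesgue_measure R).-negligible N'.
  apply: negligibleU; first apply: negligibleU => //.
  - by apply/negligibleP => //; exact: lebesgue_measure_set1.
  - by apply/negligibleP => //; exact: lebesgue_measure_set1.
have d20 : 0 < d / 2 by rewrite divr_gt0.
have [V [oO NO Od]] := negligible_open_cover N'0 d20.
(* The list [s] records the intervals tagged at exceptional points, in increasing order; the slope
   [e] pays for the rest of [[u, v]]. Concatenation of lists makes [P] additive. *)
pose P (u v : R) := exists s : seq (R * R),
  [/\ all (fun z => [&& u <= z.1, z.1 <= z.2 & z.2 <= v]) s,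
      pairwise (fun y z => y.2 <= z.1) s,
      (forall z, z \in s -> `]z.1, z.2[%classic `<=` V) &
      f v - f u <= e * (v - u) + \sum_(z <- s) (f z.2 - f z.1)].
have : P a b.
  apply: (cousin ab).
  - move=> l m r /andP[al lm] /andP[mr rb] [s1 [as1 ps1 O1 h1]] [s2 [as2 ps2 O2 h2]].
    exists (s1 ++ s2); split.
    + rewrite all_cat; apply/andP; split.
        by apply: sub_all as1 => z /= /and3P[-> -> zm]; exact: le_trans mr.
      by apply: sub_all as2 => z /= /and3P[mz -> ->]; rewrite (le_trans lm mz).
    + rewrite pairwise_cat ps1 ps2 !andbT.
      apply/allrelP => y z /(allP as1) /= /and3P[_ _ ym] /(allP as2) /= /and3P[mz _ _].
      exact: le_trans mz.
    + by move=> z; rewrite mem_cat => /orP[/O1|/O2].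
    + by rewrite big_cat/=; lra.
  - move=> t /andP[at_ tb].
    have [Nt|Nt] := pselect (N' t).
      have /nbhs_ballP[c /= c0 hc] := open_nbhs_nbhs (conj oO (NO _ Nt)).
      exists c => // l r /andP[al lt] /andP[tr rb] lrc.
      exists [:: (l, r)]; split => //=.
      * by rewrite lexx lexx (le_trans lt tr).
      * move=> z; rewrite inE => /eqP -> x /=; rewrite in_itv/= => /andP[lx xr].
        by apply: hc; rewrite /ball/= ltr_norml; lra.
      * rewrite big_seq1/= lerDr mulr_ge0 ?(ltW e0)//; lra.
    have abt : a < t < b.
      rewrite !lt_neqAle at_ tb !andbT; apply/andP; split; apply/eqP => E; apply: Nt.
        by left; right.
      by right.
    have [|l dl l0] := df t abt; first by move=> Nt'; apply: Nt; left; left.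
    have [c c0 hc] := is_derive_upper_slope dl l0 e0.
    exists c => // u v /andP[au ut] /andP[tv vb] uvc.
    by exists [::]; split => //; rewrite big_nil addr0 hc// ut.
move=> [s [as_ ps Os hs]].
have asn (i : 'I_(size s)) : 
    [&& a <= (nth (a, a) s i).1, (nth (a, a) s i).1 <= (nth (a, a) s i).2
      & (nth (a, a) s i).2 <= b].
  exact: (allP as_ _ (mem_nth _ (ltn_ord i))).
have disj : trivIset setT
    (fun i : 'I_(size s) => `](nth (a, a) s i).1, (nth (a, a) s i).2[%classic).
  have lt_disj (i j : 'I_(size s)) : (i < j)%N ->
      (nth (a, a) s i).2 <= (nth (a, a) s j).1.
    by move=> ij; apply: (pairwiseP (a, a) ps) => //; rewrite inE.
  move=> i j _ _ [x [/=]]; rewrite !in_itv/= => /andP[xi1 xi2] /andP[xj1 xj2].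
  apply/val_inj; case: (ltngtP i j) => // /lt_disj h; exfalso; lra.
have /hd : forall i : 'I_(size s), a <= (nth (a, a) s i).1 /\
    (nth (a, a) s i).1 <= (nth (a, a) s i).2 /\ (nth (a, a) s i).2 <= b.
  by move=> i; have /and3P[-> -> ->] := asn i.
move=> /(_ disj) {}hd.
have : \sum_(i < size s) ((nth (a, a) s i).2 - (nth (a, a) s i).1) < d.
  rewrite -lte_fin; apply: (@le_lt_trans _ _ (d / 2)%:E); last first.
    by rewrite lte_fin; lra.
  apply: le_trans Od; apply: sum_disjoint_itv_le => //.
    by move=> i; have /and3P[] := asn i.
  by move=> i; apply: Os; exact: mem_nth.
move=> /hd {}hd.
have hle : \sum_(z <- s) (f z.2 - f z.1) <= e.
  rewrite (big_nth (a, a)) big_mkord; apply: le_trans (ltW hd).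
  by apply: ler_sum => i _; exact: ler_norm.
have ee : e * (b - a) + e = e' by rewrite /e; field; lra.
lra.
Qed.

(** Absolute continuity only sees increments. Lipschitz maps, sums, products and linear images below
    are all instances of this domination. *)
Lemma ac_dominated (R : realType) (U V W : normedModType R) (a b K : R)
    (f : R -> U) (g : R -> V) (h : R -> W) : 0 <= K ->
  absolutely_continuous a b f -> absolutely_continuous a b g ->
  (forall x y, a <= x <= b -> a <= y <= b ->
     `|h x - h y| <= K * (`|f x - f y| + `|g x - g y|)) ->
  absolutely_continuous a b h.
Proof.
move=> K0 acf acg fgh e e0.
pose e' := e / (2 * K + 1).
have K1 : 0 < 2 * K + 1 by lra.
have e'0 : 0 < e' by rewrite divr_gt0.
have [d1 d10 h1] := acf _ e'0; have [d2 d20 h2] := acg _ e'0.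
exists (Num.min d1 d2); first by rewrite lt_min d10.
move=> m l r lr tr; rewrite lt_min => /andP[s1 s2].
have {}h1 := h1 _ _ _ lr tr s1; have {}h2 := h2 _ _ _ lr tr s2.
apply: (@le_lt_trans _ _
  (\sum_i K * (`|f (r i) - f (l i)| + `|g (r i) - g (l i)|))).
  by apply: ler_sum => i _; have [ali [lri rib]] := lr i; apply: fgh; lra.
rewrite -mulr_sumr big_split /=.
have eE : e = (2 * K + 1) * e' by rewrite /e'; field; lra.
rewrite eE; apply: (@le_lt_trans _ _ (K * (e' + e'))).
  by apply: ler_wpM2l => //; lra.
lra.
Qed.

Lemma ac_id (R : realType) (a b : R) : absolutely_continuous a b (@id R).
Proof.
move=> e e0; exists e => // m l r lr _; apply: le_lt_trans.
by apply: ler_sum => i _; have [_ [lri _]] := lr i; rewrite /= ger0_norm// subr_ge0.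
Qed.

Lemma ac_lipschitz (R : realType) (V : normedModType R) (a b K : R) (h : R -> V) :
  0 <= K ->
  (forall x y, a <= x <= b -> a <= y <= b -> `|h x - h y| <= K * `|x - y|) ->
  absolutely_continuous a b h.
Proof.
move=> K0 hK; apply: (ac_dominated K0 (@ac_id _ a b) (@ac_id _ a b)) => x y xab yab.
by rewrite mulrDr (le_trans (hK _ _ xab yab))// lerDl mulr_ge0.
Qed.

Lemma ac_cst (R : realType) (V : normedModType R) (a b : R) (c : V) :
  absolutely_continuous a b (fun=> c).
Proof.
by apply: (@ac_lipschitz _ _ _ _ 0) => // x y _ _; rewrite subrr normr0 mul0r.
Qed.

Lemma acD (R : realType) (V : normedModType R) (a b : R) (f g : R -> V) :
  absolutely_continuous a b f -> absolutely_continuous a b g ->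
  absolutely_continuous a b (fun x => f x + g x).
Proof.
move=> acf acg; apply: (@ac_dominated _ _ _ _ _ _ 1 f g) => // x y _ _.
by rewrite mul1r opprD addrACA ler_normD.
Qed.

Lemma ac_uniformly_continuous (R : realType) (V : normedModType R) (a b e : R) (f : R -> V) :
  absolutely_continuous a b f -> 0 < e ->
  exists2 d, 0 < d & forall x y, a <= x <= b -> a <= y <= b -> `|x - y| < d ->
    `|f x - f y| < e.
Proof.
move=> acf e0; have [d d0 hd] := acf _ e0; exists d => //.
have main x y : a <= x -> x <= y -> y <= b -> y - x < d -> `|f y - f x| < e.
  move=> ax xy yb yxd.
  have := hd 1%N (fun=> x) (fun=> y); rewrite !big_ord1; apply => //.
  by move=> i j _ _ _; rewrite !ord1.
move=> x y /andP[ax xb] /andP[ay yb]; have [xy|/ltW yx] := leP x y.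
  by rewrite distrC ger0_norm ?subr_ge0// => ?; rewrite distrC main.
by rewrite ger0_norm ?subr_ge0// => ?; rewrite main.
Qed.

(** Near [t] the number [|f t| + 1] is a bound by uniform continuity, and bounds on adjacent
    intervals can be added, so Cousin's lemma applies. The bound serves for products. *)
Lemma ac_bounded (R : realType) (V : normedModType R) (a b : R) (f : R -> V) :
  absolutely_continuous a b f ->
  exists2 B, 0 <= B & forall x, a <= x <= b -> `|f x| <= B.
Proof.
move=> acf; have [ab|ba] := leP a b; last first.
  by exists 0 => // x /andP[ax xb]; have := le_trans ax xb; rewrite leNgt ba.
have [d d0 hd] := ac_uniformly_continuous acf ltr01.
pose P u v := exists2 B, 0 <= B & forall x, u <= x <= v -> `|f x| <= B.
apply: (cousin (P := P) ab).
  move=> l m r _ _ [B1 B10 h1] [B2 B20 h2].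
  exists (B1 + B2) => [|x /andP[lx xr]]; first exact: addr_ge0.
  have [xm|/ltW mx] := leP x m.
    by rewrite (le_trans (h1 _ _)) ?lx// lerDl.
  by rewrite (le_trans (h2 _ _)) ?mx// lerDr.
move=> t tab; exists d => // l r /andP[al lt] /andP[tr rb] lrd.
exists (`|f t| + 1) => [|x /andP[lx xr]]; first by rewrite addr_ge0.
have {}hd : `|f x - f t| < 1.
  by apply: hd => //; [lra | rewrite ltr_norml; lra].
have -> : f x = f t + (f x - f t) by rewrite addrC subrK.
by rewrite (le_trans (ler_normD _ _))// lerD2l ltW.
Qed.

Lemma acM (R : realType) (a b : R) (f g : R -> R) :
  absolutely_continuous a b f -> absolutely_continuous a b g ->
  absolutely_continuous a b (fun x => f x * g x).
Proof.
move=> acf acg.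
have [B1 B10 hB1] := ac_bounded acf; have [B2 B20 hB2] := ac_bounded acg.
apply: (@ac_dominated _ _ _ _ _ _ (B1 + B2) f g) => //; first exact: addr_ge0.
move=> x y xab yab.
have -> : f x * g x - f y * g y = f x * (g x - g y) + (f x - f y) * g y by ring.
apply: le_trans (ler_normD _ _) _; rewrite !normrM.
have := ler_wpM2r (normr_ge0 (g x - g y)) (hB1 _ xab).
have := ler_wpM2l (normr_ge0 (f x - f y)) (hB2 _ yab).
have := mulr_ge0 B10 (normr_ge0 (f x - f y)).
have := mulr_ge0 B20 (normr_ge0 (g x - g y)).
lra.
Qed.

Lemma ac_sum (R : realType) (V : normedModType R) (a b : R) (I : Type) (s : seq I)
    (f : I -> R -> V) :
  (forall i, absolutely_continuous a b (f i)) ->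
  absolutely_continuous a b (fun x => \sum_(i <- s) f i x).
Proof.
move=> acf; elim: s => [|i s IH].
  rewrite (_ : (fun x => _) = (fun=> 0)); first exact: ac_cst.
  by apply/funext => x; rewrite big_nil.
rewrite (_ : (fun x => _) = (fun x => f i x + \sum_(j <- s) f j x)); first exact: acD.
by apply/funext => x; rewrite big_cons.
Qed.

(** By [1 + z <= exp z] an increment is at most the slope at its larger point times the step, and
    that slope is at most the one at [b]. *)
Lemma ac_expR (R : realType) (a b c : R) : 0 <= c ->
  absolutely_continuous a b (fun x => expR (c * x)).
Proof.
move=> c0; apply: (@ac_lipschitz _ _ _ _ (c * expR (c * b))).
  by rewrite mulr_ge0// expR_ge0.
have main x y : x <= y -> y <= b ->
    `|expR (c * x) - expR (c * y)| <= c * expR (c * b) * `|x - y|.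
  move=> xy yb; rewrite !ler0_norm ?subr_le0 ?ler_expR ?ler_wpM2l// !opprB.
  have h : expR (c * x) = expR (c * y) * expR (c * x - c * y).
    by rewrite -expRD; congr expR; ring.
  have := expR_ge1Dx (c * x - c * y).
  have := expR_gt0 (c * y); set E := expR (c * y) in h * => E0 /(ler_wpM2l (ltW E0)).
  rewrite -h => {}h.
  have : E * (c * (y - x)) <= expR (c * b) * (c * (y - x)).
    by rewrite ler_wpM2r ?mulr_ge0 ?subr_ge0 ?ler_expR ?ler_wpM2l.
  lra.
move=> x y /andP[_ xb] /andP[_ yb]; have [xy|/ltW yx] := leP x y; first exact: main.
by rewrite distrC (distrC x); exact: main.
Qed.

(** The identity assumed of [phi] is the linearity that difference quotients use; the bound makes
    [phi] continuous, so that it passes through the limit. *)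
Lemma is_derive_linear_comp (R : realType) (V : normedModType R) (phi : V -> R) (K : R)
    (f : R -> V) (t : R) (df : V) :
  (forall c u v, phi (c *: (u - v)) = c * (phi u - phi v)) ->
  (forall u, `|phi u| <= K * `|u|) ->
  is_derive t 1 f df -> is_derive t 1 (fun x => phi (f x)) (phi df).
Proof.
move=> phiL phiK [dbl <-].
have phiB u v : phi u - phi v = phi (u - v) by rewrite -[u - v]scale1r phiL mul1r.
have K0 : 0 <= `|K| + 1 by rewrite addr_ge0.
have cphi : continuous phi.
  move=> u; apply/cvgrPdist_lt => e e0; near=> v.
  rewrite phiB (le_lt_trans (phiK _))//.
  rewrite (@le_lt_trans _ _ ((`|K| + 1) * `|u - v|))//.
    by rewrite ler_wpM2r// (le_trans (ler_norm K))// lerDl.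
  rewrite mulrC -ltr_pdivlMr ?ltr_wpDl//.
  near: v; apply/nbhs_normP; exists (e / (`|K| + 1)) => //=.
  by rewrite divr_gt0// ltr_wpDl.
have h : (fun h : R => h^-1 *: (((fun x => phi (f x)) \o shift t) (h *: 1) - phi (f t) : R^o))
    @ 0^' --> phi ('D_1 f t).
  have -> : (fun h : R => h^-1 *: (((fun x => phi (f x)) \o shift t) (h *: 1) - phi (f t) : R^o)) =
      phi \o (fun h : R => h^-1 *: ((f \o shift t) (h *: 1) - f t)).
    by apply/funext => h /=; rewrite phiL.
  by apply: cvg_comp; [exact: dbl|exact: cphi].
by apply: DeriveDef; [apply/cvg_ex; exists (phi ('D_1 f t))|exact/cvg_lim].
Unshelve. all: by end_near. Qed.

Lemma ac_linear_comp (R : realType) (V : normedModType R) (phi : V -> R) (K a b : R)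
    (f : R -> V) :
  (forall c u v, phi (c *: (u - v)) = c * (phi u - phi v)) ->
  (forall u, `|phi u| <= K * `|u|) ->
  absolutely_continuous a b f -> absolutely_continuous a b (fun x => phi (f x)).
Proof.
move=> phiL phiK acf.
apply: (ac_dominated (normr_ge0 K) acf (@ac_cst R R^o a b 0)) => x y _ _.
rewrite subrr normr0 addr0 -[phi _ - _]mul1r -phiL scale1r (le_trans (phiK _))//.
by rewrite ler_wpM2r// ler_norm.
Qed.

(** A solution is constrained only in the interior of a time slice; by continuity, identities that
    hold there extend to the end points. *)
Lemma ac_cst_closed (R : realType) (a b c : R) (f : R -> R) : a < b ->
  absolutely_continuous a b f -> (forall t, a < t < b -> f t = c) -> f a = c /\ f b = c.
Proof.
move=> ab acf fc.
have close e : 0 < e -> `|f a - c| < e /\ `|f b - c| < e.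
  move=> e0; have [d d0 hd] := ac_uniformly_continuous acf e0.
  pose h := Num.min (d / 2) ((b - a) / 2).
  have hd2 : h <= d / 2 by rewrite ge_min lexx.
  have hab : h <= (b - a) / 2 by rewrite ge_min lexx orbT.
  have h0 : 0 < h by rewrite lt_min !divr_gt0// subr_gt0.
  clearbody h; split.
    rewrite -(fc (a + h)); last lra.
    by apply: hd; [lra|lra|rewrite opprD addNKr normrN gtr0_norm//; lra].
  rewrite -(fc (b - h)); last lra.
  by apply: hd; [lra|lra|rewrite subKr gtr0_norm//; lra].
have z (y : R) : (forall e, 0 < e -> `|y| < e) -> y = 0.
  move=> hy; apply/eqP; rewrite -normr_eq0; apply/eqP/le_anti.
  by rewrite normr_ge0 andbT; apply/ler_addgt0Pr => e /hy /ltW; rewrite add0r.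
by split; apply/eqP; rewrite -subr_eq0; apply/eqP/z => e /close [].
Qed.

(** The product of [f] with the integrating factor [expR (c * t)] has a nonpositive derivative
    almost everywhere. *)
Lemma ac_gronwall (R : realType) (a b c : R) (f : R -> R) (N : set R) :
  a <= b -> 0 <= c -> absolutely_continuous a b f ->
  (@lebesgue_measure R).-negligible N ->
  (forall t, a < t < b -> ~ N t -> exists2 l, is_derive t 1 f l & l <= - c * f t) ->
  f b <= expR (- c * (b - a)) * f a.
Proof.
move=> ab c0 acf N0 df.
have acE := ac_expR a b c0.
have : expR (c * b) * f b <= expR (c * a) * f a.
  apply: (ac_le ab (acM acE acf) N0) => t tab Nt.
  have [l dl hl] := df t tab Nt.
  have dE : is_derive t 1 (fun x => expR (c * x)) (expR (c * t) * c).
    apply: (@is_derive1_comp _ expR (fun x => c * x)).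
    by apply: is_derive_eq; rewrite /GRing.scale/= mulr1.
  have dM := is_deriveM dE dl.
  exists (expR (c * t) * l + f t * (expR (c * t) * c)); first exact: dM.
  have := ler_wpM2l (expR_ge0 (c * t)) hl; lra.
have -> : expR (- c * (b - a)) = expR (c * a) / expR (c * b).
  by rewrite -expRN -expRD; congr expR; ring.
by rewrite mulrAC ler_pdivlMr ?expR_gt0// mulrC.
Qed.

(** * Rotations and quaternions *)

Lemma ord3_ind (P : 'I_3 -> Prop) : P 0 -> P 1 -> P 2 -> forall i, P i.
Proof.
move=> P0 P1 P2 [[|[|[|//]]] i3].
- by rewrite (_ : Ordinal i3 = 0)//; exact: val_inj.
- by rewrite (_ : Ordinal i3 = 1)//; exact: val_inj.
- by rewrite (_ : Ordinal i3 = 2)//; exact: val_inj.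
Qed.

Lemma sum3E (V : nmodType) (F : 'I_3 -> V) : \sum_i F i = F 0 + F 1 + F 2.
Proof.
rewrite !big_ord_recl big_ord0 addr0 addrA.
by congr (_ + F _ + F _); exact: val_inj.
Qed.

Ltac mx3 := apply/matrixP; apply: ord3_ind; apply: ord3_ind.

Section Coordinates.
Context {R : realType}.
Implicit Types (A B M Q : 'M[R]_3) (x y u v : 'cV[R]_3).

Lemma mulmx3E m n (A : 'M[R]_(m, 3)) (B : 'M[R]_(3, n)) i j :
  (A *m B) i j = A i 0 * B 0 j + A i 1 * B 1 j + A i 2 * B 2 j.
Proof. by rewrite mxE sum3E. Qed.

Lemma dot3E x y : dot x y = x 0 0 * y 0 0 + x 1 0 * y 1 0 + x 2 0 * y 2 0.
Proof. by rewrite /dot mulmx3E !mxE. Qed.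

Lemma mxtrace3E A : \tr A = A 0 0 + A 1 1 + A 2 2.
Proof. exact: sum3E. Qed.

Lemma skewE x :
  ((skew x 0 0 = 0)%R *
   (skew x 0 1 = - x 2 0)%R *
   (skew x 0 2 = x 1 0)%R *
   (skew x 1 0 = x 2 0)%R *
   (skew x 1 1 = 0)%R *
   (skew x 1 2 = - x 0 0)%R *
   (skew x 2 0 = - x 1 0)%R *
   (skew x 2 1 = x 0 0)%R *
   (skew x 2 2 = 0)%R)%type.
Proof. by do ?split; rewrite mxE. Qed.

Lemma one3E :
  (((1%:M : 'M[R]_3) 0 0 = 1)%R *
   ((1%:M : 'M[R]_3) 0 1 = 0)%R *
   ((1%:M : 'M[R]_3) 0 2 = 0)%R *
   ((1%:M : 'M[R]_3) 1 0 = 0)%R *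
   ((1%:M : 'M[R]_3) 1 1 = 1)%R *
   ((1%:M : 'M[R]_3) 1 2 = 0)%R *
   ((1%:M : 'M[R]_3) 2 0 = 0)%R *
   ((1%:M : 'M[R]_3) 2 1 = 0)%R *
   ((1%:M : 'M[R]_3) 2 2 = 1)%R)%type.
Proof. by do ?split; rewrite mxE. Qed.

Lemma det3E A : \det A =
  A 0 0 * (A 1 1 * A 2 2 - A 1 2 * A 2 1) - A 0 1 * (A 1 0 * A 2 2 - A 1 2 * A 2 0)
  + A 0 2 * (A 1 0 * A 2 1 - A 1 1 * A 2 0).
Proof.
(* Entries are read through natural numbers, so that the indices produced by the cofactor expansion
   compute. *)
have [f AE] : exists f : nat -> nat -> R, forall i j, A i j = f i j.
  by exists (fun i j => A (inord i) (inord j)) => i j; rewrite !inord_val.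
rewrite (expand_det_row _ 0) sum3E /cofactor.
rewrite !(expand_det_row _ ord0) !big_ord_recl !big_ord0 /cofactor !det_mx11 !mxE.
rewrite !AE /= /bump /=; ring.
Qed.

Lemma skew_sqr u : skew u *m skew u = u *m u^T - (sqnorm u)%:M.
Proof.
apply/matrixP; apply: ord3_ind; apply: ord3_ind;
rewrite mulmx3E !mxE big_ord1 !mxE /sqnorm dot3E /=; ring.
Qed.

(** For [h ^+ 2 + sqnorm e = 1] this is the rotation of the unit quaternion with scalar part [h] and
    vector part [e]. *)
Definition rotq (h : R) (e : 'cV[R]_3) : 'M[R]_3 :=
  1%:M + (2 * h) *: skew e + 2 *: (skew e *m skew e).

Lemma rotqE h e :
  ((rotq h e 0 0 = 1 - 2 * (e 1 0 ^+ 2 + e 2 0 ^+ 2))%R *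
   (rotq h e 0 1 = 2 * (e 0 0 * e 1 0 - h * e 2 0))%R *
   (rotq h e 0 2 = 2 * (e 0 0 * e 2 0 + h * e 1 0))%R *
   (rotq h e 1 0 = 2 * (e 0 0 * e 1 0 + h * e 2 0))%R *
   (rotq h e 1 1 = 1 - 2 * (e 0 0 ^+ 2 + e 2 0 ^+ 2))%R *
   (rotq h e 1 2 = 2 * (e 1 0 * e 2 0 - h * e 0 0))%R *
   (rotq h e 2 0 = 2 * (e 0 0 * e 2 0 - h * e 1 0))%R *
   (rotq h e 2 1 = 2 * (e 1 0 * e 2 0 + h * e 0 0))%R *
   (rotq h e 2 2 = 1 - 2 * (e 0 0 ^+ 2 + e 1 0 ^+ 2))%R)%type.
Proof.
by do ?split; rewrite mxE mxE [X in _ + X + _]mxE [X in _ + _ + X]mxE mulmx3E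
  !skewE one3E; ring.
Qed.


Lemma sym3E M : M^T = M -> ((M 1 0 = M 0 1)%R * (M 2 0 = M 0 2)%R * (M 2 1 = M 1 2)%R)%type.
Proof. by move=> /matrixP MT; do ?split; rewrite -[RHS]MT mxE. Qed.

(** The term in [skew e] has zero trace against a symmetric matrix, so [h] drops out; the term in
    the square of [skew e] gives the quadratic form of [tr(M) I - M]. *)
Lemma mxtrace_rotq M h e : M^T = M ->
  \tr ((1%:M - rotq h e) *m M) = 2 * (\tr M * sqnorm e - dot e (M *m e)).
Proof.
move=> /sym3E MT.
have subE i j : (1%:M - rotq h e) i j = (1%:M : 'M[R]_3) i j - rotq h e i j.
  by rewrite mxE; congr (_ + _); rewrite mxE.
rewrite [LHS]mxtrace3E !mulmx3E.
rewrite !subE !rotqE !one3E /sqnorm !dot3E !mulmx3E mxtrace3E !MT; ring.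
Qed.

Lemma SO3_mulTmx Q : SO3 Q -> Q^T *m Q = 1%:M.
Proof. by move=> [QQ _]; apply: mulmx1C. Qed.

Lemma SO3_adj Q : SO3 Q -> Q^T = \adj Q.
Proof.
move=> SQ; have [_ dQ] := SQ.
by rewrite -[RHS]mul1mx -(SO3_mulTmx SQ) -mulmxA mul_mx_adj dQ mulmx1.
Qed.

(** The transpose and the adjugate of a rotation are both its inverse. Together with the
    orthogonality of rows and columns, these quadratic relations are what the quaternion
    representation is computed from. *)
Lemma SO3_cofactor Q : SO3 Q ->
  ((Q 0 0 = Q 1 1 * Q 2 2 - Q 1 2 * Q 2 1)%R *
   (Q 0 1 = Q 1 2 * Q 2 0 - Q 1 0 * Q 2 2)%R *
   (Q 0 2 = Q 1 0 * Q 2 1 - Q 1 1 * Q 2 0)%R *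
   (Q 1 0 = Q 0 2 * Q 2 1 - Q 0 1 * Q 2 2)%R *
   (Q 1 1 = Q 0 0 * Q 2 2 - Q 0 2 * Q 2 0)%R *
   (Q 1 2 = Q 0 1 * Q 2 0 - Q 0 0 * Q 2 1)%R *
   (Q 2 0 = Q 0 1 * Q 1 2 - Q 0 2 * Q 1 1)%R *
   (Q 2 1 = Q 0 2 * Q 1 0 - Q 0 0 * Q 1 2)%R *
   (Q 2 2 = Q 0 0 * Q 1 1 - Q 0 1 * Q 1 0)%R)%type.
Proof.
move=> /SO3_adj /matrixP QA.
have {}QA i j : Q i j = cofactor Q i j by have := QA j i; rewrite !mxE.
have [f QE] : exists f : nat -> nat -> R, forall i j, Q i j = f i j.
  by exists (fun i j => Q (inord i) (inord j)) => i j; rewrite !inord_val.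
by do ?split; rewrite [LHS]QA /cofactor (expand_det_row _ ord0) !big_ord_recl !big_ord0
  /cofactor !det_mx11 !mxE !QE /= /bump /=; ring.
Qed.

Lemma SO3_dot_rows Q i j : SO3 Q ->
  Q i 0 * Q j 0 + Q i 1 * Q j 1 + Q i 2 * Q j 2 = (i == j)%:R.
Proof.
by move=> [/matrixP/(_ i j) + _]; rewrite mulmx3E !mxE => ->.
Qed.

Lemma SO3_dot_cols Q i j : SO3 Q ->
  Q 0 i * Q 0 j + Q 1 i * Q 1 j + Q 2 i * Q 2 j = (i == j)%:R.
Proof.
by move=> /SO3_mulTmx/matrixP/(_ i j); rewrite mulmx3E !mxE => ->.
Qed.

(* The vector [k] is a column of [4 q q^T], [q = (h, e)], and [T] its diagonal entry:
   the entries of [4 q q^T] are linear in those of [Q], and [q = k / sqrt (4 T)]. *)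
Lemma rotq_of_scaled Q (T k0 k1 k2 k3 : R) : 0 < T ->
  k0 ^+ 2 + k1 ^+ 2 + k2 ^+ 2 + k3 ^+ 2 = 4 * T ->
  T * (1 - Q 0 0) * 2 = k2 ^+ 2 + k3 ^+ 2 ->
  T * (1 - Q 1 1) * 2 = k1 ^+ 2 + k3 ^+ 2 ->
  T * (1 - Q 2 2) * 2 = k1 ^+ 2 + k2 ^+ 2 ->
  2 * T * Q 0 1 = k1 * k2 - k0 * k3 -> 2 * T * Q 1 0 = k1 * k2 + k0 * k3 ->
  2 * T * Q 0 2 = k1 * k3 + k0 * k2 -> 2 * T * Q 2 0 = k1 * k3 - k0 * k2 ->
  2 * T * Q 1 2 = k2 * k3 - k0 * k1 -> 2 * T * Q 2 1 = k2 * k3 + k0 * k1 ->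
  exists h e, h ^+ 2 + sqnorm e = 1 /\ Q = rotq h e.
Proof.
move=> T0 kk q00 q11 q22 q01 q10 q02 q20 q12 q21.
pose t := Num.sqrt (4 * T).
have t2 : t ^+ 2 = 4 * T by rewrite sqr_sqrtr// mulr_ge0// ltW.
have t0 : t != 0 by rewrite gt_eqF// sqrtr_gt0 mulr_gt0.
pose e : 'cV[R]_3 := \col_i nth 0 [:: k1 / t; k2 / t; k3 / t] i.
have e0 : e 0 0 = k1 / t by rewrite mxE.
have e1 : e 1 0 = k2 / t by rewrite mxE.
have e2 : e 2 0 = k3 / t by rewrite mxE.
have P (x y : R) : (x / t) * (y / t) = (x * y) / (4 * T) by rewrite -t2; field.
have T4 : 4 * T != 0 by rewrite gt_eqF// mulr_gt0.
have PE (x y z : R) : 2 * T * x = y -> z * 2 = y / T -> x = z.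
  move=> xy zy; apply: (@mulfI _ (2 * T)); first by rewrite gt_eqF// mulr_gt0.
  rewrite xy; have -> : y = (y / T) * T by rewrite divfK// gt_eqF.
  by rewrite -zy; ring.
have T0' : T != 0 by rewrite gt_eqF.
exists (k0 / t), e; split.
  rewrite /sqnorm dot3E e0 e1 e2 expr2 !P -!mulrDl -!expr2 !addrA kk divff//.
mx3; rewrite !rotqE ?e0 ?e1 ?e2 ?expr2 ?P.
- apply: (PE _ (2 * T - (k2 ^+ 2 + k3 ^+ 2))); [lra | field => //].
- by apply: (PE _ _ _ q01); field.
- by apply: (PE _ _ _ q02); field.
- by apply: (PE _ _ _ q10); field.
- apply: (PE _ (2 * T - (k1 ^+ 2 + k3 ^+ 2))); [lra | field => //].
- by apply: (PE _ _ _ q12); field.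
- by apply: (PE _ _ _ q20); field.
- by apply: (PE _ _ _ q21); field.
- apply: (PE _ (2 * T - (k1 ^+ 2 + k2 ^+ 2))); [lra | field => //].
Qed.

(** Shepperd's method: [T0], [T1], [T2], [T3] are four times the squared components of the
    quaternion. They add up to 4, so one of them is positive and the corresponding column can be
    normalised. *)
Lemma SO3_rotq Q : SO3 Q -> exists h e, h ^+ 2 + sqnorm e = 1 /\ Q = rotq h e.
Proof.
move=> SQ.
have r00 := SO3_dot_rows 0 0 SQ. have r01 := SO3_dot_rows 0 1 SQ.
have r02 := SO3_dot_rows 0 2 SQ. have r11 := SO3_dot_rows 1 1 SQ.
have r12 := SO3_dot_rows 1 2 SQ. have r22 := SO3_dot_rows 2 2 SQ.
have c00 := SO3_dot_cols 0 0 SQ. have c01 := SO3_dot_cols 0 1 SQ.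
have c02 := SO3_dot_cols 0 2 SQ. have c11 := SO3_dot_cols 1 1 SQ.
have c12 := SO3_dot_cols 1 2 SQ. have c22 := SO3_dot_cols 2 2 SQ.
have [[[[[[[[f00 f01] f02] f10] f11] f12] f20] f21] f22] := SO3_cofactor SQ.
simpl in r00, r01, r02, r11, r12, r22, c00, c01, c02, c11, c12, c22.
(* Every identity left to [lra] is a linear combination of either the diagonal or the
   off-diagonal relations above; [lra] is slow when given all of them. *)
pose T0 := 1 + Q 0 0 + Q 1 1 + Q 2 2.
pose T1 := 1 + Q 0 0 - Q 1 1 - Q 2 2.
pose T2 := 1 - Q 0 0 + Q 1 1 - Q 2 2.
pose T3 := 1 - Q 0 0 - Q 1 1 + Q 2 2.
pose k01 := Q 2 1 - Q 1 2. pose k02 := Q 0 2 - Q 2 0. pose k03 := Q 1 0 - Q 0 1.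
pose k12 := Q 0 1 + Q 1 0. pose k13 := Q 0 2 + Q 2 0. pose k23 := Q 1 2 + Q 2 1.
have [h0|h0] := ltP 0 T0.
  apply: (@rotq_of_scaled Q T0 T0 k01 k02 k03) => //; rewrite /T0 /k01 /k02 /k03.
  5-10: by clear r00 r11 r22 c00 c11 c22 f00 f11 f22; lra.
  1-4: by clear r01 r02 r12 c01 c02 c12 f01 f02 f10 f12 f20 f21; lra.
have [h1|h1] := ltP 0 T1.
  apply: (@rotq_of_scaled Q T1 k01 T1 k12 k13) => //; rewrite /T1 /k01 /k12 /k13.
  5-10: by clear r00 r11 r22 c00 c11 c22 f00 f11 f22; lra.
  1-4: by clear r01 r02 r12 c01 c02 c12 f01 f02 f10 f12 f20 f21; lra.
have [h2|h2] := ltP 0 T2.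
  apply: (@rotq_of_scaled Q T2 k02 k12 T2 k23) => //; rewrite /T2 /k02 /k12 /k23.
  5-10: by clear r00 r11 r22 c00 c11 c22 f00 f11 f22; lra.
  1-4: by clear r01 r02 r12 c01 c02 c12 f01 f02 f10 f12 f20 f21; lra.
have [h3|h3] := ltP 0 T3.
  apply: (@rotq_of_scaled Q T3 k03 k13 k23 T3) => //; rewrite /T3 /k03 /k13 /k23.
  5-10: by clear r00 r11 r22 c00 c11 c22 f00 f11 f22; lra.
  1-4: by clear r01 r02 r12 c01 c02 c12 f01 f02 f10 f12 f20 f21; lra.
by exfalso; move: h0 h1 h2 h3; rewrite /T0 /T1 /T2 /T3; lra.
Qed.

End Coordinates.

Section Rotations.
Context {R : realType}.
Implicit Types (A B M Q : 'M[R]_3) (x y u v e : 'cV[R]_3).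

Lemma rotq_SO3 h e : h ^+ 2 + sqnorm e = 1 -> SO3 (rotq h e).
Proof.
rewrite /sqnorm dot3E => n1.
(* With the constant 1 eliminated, all entries are homogeneous of degree two in [(h, e)]. Writing 1
   as a power of [h^2 + |e|^2] then turns orthogonality and the determinant into polynomial
   identities. *)
have q00 : rotq h e 0 0 = h ^+ 2 + e 0 0 ^+ 2 - e 1 0 ^+ 2 - e 2 0 ^+ 2.
  by rewrite rotqE; lra.
have q11 : rotq h e 1 1 = h ^+ 2 - e 0 0 ^+ 2 + e 1 0 ^+ 2 - e 2 0 ^+ 2.
  by rewrite rotqE; lra.
have q22 : rotq h e 2 2 = h ^+ 2 - e 0 0 ^+ 2 - e 1 0 ^+ 2 + e 2 0 ^+ 2.
  by rewrite rotqE; lra.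
split; last first.
  rewrite det3E q00 q11 q22 !rotqE -[RHS](expr1n _ 3) -[in RHS]n1; ring.
have n2 : 1 = (h ^+ 2 + (e 0 0 * e 0 0 + e 1 0 * e 1 0 + e 2 0 * e 2 0)) ^+ 2.
  by rewrite n1 expr1n.
have one i j : (1%:M : 'M[R]_3) i j =
    (h ^+ 2 + (e 0 0 * e 0 0 + e 1 0 * e 1 0 + e 2 0 * e 2 0)) ^+ 2 * (1%:M : 'M[R]_3) i j.
  by rewrite -n2 mul1r.
by mx3; rewrite mulmx3E one ![(rotq h e)^T _ _]mxE one3E ?q00 ?q11 ?q22 ?rotqE; ring.
Qed.

Lemma angle_axis_rotq theta u :
  angle_axis theta u = rotq (cos (theta / 2)) (sin (theta / 2) *: u).
Proof.
have cE : cos theta = cos (theta / 2) ^+ 2 *+ 2 - 1.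
  by rewrite -cos_mulr2n; congr cos; rewrite mulr2n; field.
have sE : sin theta = (cos (theta / 2) * sin (theta / 2)) *+ 2.
  by rewrite -sin_mulr2n; congr sin; rewrite mulr2n; field.
have cs := cos2Dsin2 (theta / 2).
have skewZ : skew (sin (theta / 2) *: u) = sin (theta / 2) *: skew u.
  by mx3; rewrite [RHS]mxE !skewE ?mxE; ring.
rewrite /angle_axis /rotq skewZ -scalemxAl -scalemxAr !scalerA.
congr (_ + _ *: _ + _ *: _); rewrite ?sE ?cE mulr2n; first ring.
lra.
Qed.

Lemma angle_axis_SO3 theta u : sqnorm u = 1 -> SO3 (angle_axis theta u).
Proof.
move=> u1; rewrite angle_axis_rotq; apply: rotq_SO3.
rewrite -[RHS](cos2Dsin2 (theta / 2)); congr (_ + _).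
set s := sin _; suff -> : sqnorm (s *: u) = s ^+ 2 * sqnorm u by rewrite u1 mulr1.
by rewrite /sqnorm !dot3E !mxE; ring.
Qed.

Lemma sqnorm_rot_rotq h e : sqnorm_rot (rotq h e) = sqnorm e.
Proof.
have subE i : (1%:M - rotq h e) i i = (1%:M : 'M[R]_3) i i - rotq h e i i.
  by rewrite mxE; congr (_ + _); rewrite mxE.
rewrite /sqnorm_rot [\tr _]mxtrace3E !subE !one3E !rotqE /sqnorm dot3E; lra.
Qed.

Lemma mxtrace_skew_part A : \tr (skew_part A *m A) =
  - 2^-1 * ((A 1 0 - A 0 1) ^+ 2 + (A 2 0 - A 0 2) ^+ 2 + (A 2 1 - A 1 2) ^+ 2).
Proof.
have pE i j : skew_part A i j = 2^-1 * (A i j - A j i).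
  by rewrite /skew_part mxE; congr (_ * _); rewrite mxE; congr (_ + _); rewrite !mxE.
rewrite [LHS]mxtrace3E !mulmx3E !pE; lra.
Qed.

(** The left-hand side is the squared Frobenius norm of the skew part, that is, the dissipation of
    the potential per unit of [kR]. The right-hand side shows where it vanishes. *)
Lemma mxtrace_skew_part_rotq M h e : M^T = M ->
  - \tr (skew_part (M *m rotq h e) *m (M *m rotq h e)) =
  2 * (h ^+ 2 * sqnorm (\tr M *: e - M *m e) + sqnorm (skew e *m (M *m e))).
Proof.
move=> /sym3E MT; rewrite mxtrace_skew_part !mulmx3E !rotqE /sqnorm.
have wE i : (\tr M *: e - M *m e) i 0 =
    (M 0 0 + M 1 1 + M 2 2) * e i 0 - (M i 0 * e 0 0 + M i 1 * e 1 0 + M i 2 * e 2 0).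
  by rewrite -mxtrace3E -mulmx3E mxE; congr (_ + _); rewrite mxE.
rewrite !dot3E !wE !mulmx3E !skewE !MT; lra.
Qed.

Lemma mxtrace_sym_skew M u : M^T = M -> \tr (skew u *m M) = 0.
Proof. by move=> /sym3E MT; rewrite mxtrace3E !mulmx3E !skewE !MT; ring. Qed.

Lemma dot_skew x u : dot x (skew u *m x) = 0.
Proof. by rewrite dot3E !mulmx3E !skewE; ring. Qed.

(** Expansion of the double cross product of [u], [u] and [v]: parallel vectors are recovered
    without dividing by the norm. *)
Lemma skew_mul_eq0 u v : skew u *m v = 0 -> sqnorm u *: v = dot u v *: u.
Proof.
move=> uv0; have : skew u *m (skew u *m v) = 0 by rewrite uv0 mulmx0.
rewrite mulmxA skew_sqr mulmxBl mul_scalar_mx -mulmxA => /eqP.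
by rewrite subr_eq0 => /eqP <-; rewrite [u^T *m v]mx11_scalar mul_mx_scalar.
Qed.

(** The half-turn about [v] is [2 v v^T - I], so [M (I - 2 v v^T)] is [- M Q]. The sine term of
    [angle_axis] vanishes because [v] is an eigenvector of the symmetric [M]; the cosine term is the
    quadratic form that defines [gap]. *)
Lemma mxtrace_half_turn M v u theta l : M^T = M -> sqnorm v = 1 -> sqnorm u = 1 ->
  M *m v = l *: v ->
  \tr ((1%:M - rotq 0 v) *m M) - \tr ((1%:M - rotq 0 v *m angle_axis theta u) *m M) =
  (1 - cos theta) *
   (u^T *m ((\tr (M *m (1%:M - 2 *: (v *m v^T))))%:M - M *m (1%:M - 2 *: (v *m v^T)))
      *m u) 0 0.
Proof.
move=> MT v1 u1 Mv.
set Q := rotq 0 v.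
have QE : Q = - (1%:M - 2 *: (v *m v^T)).
  rewrite /Q /rotq mulr0 scale0r addr0 skew_sqr v1 scalerBr opprB.
  have -> : (2 : R) *: (1%:M : 'M[R]_3) = 1%:M + 1%:M by rewrite scaler_nat mulr2n.
  by rewrite opprD addrCA [1%:M + _]addrA subrr add0r.
have -> : 1%:M - 2 *: (v *m v^T) = - Q by rewrite QE opprK.
clearbody Q.
rewrite mulmxN.
have vT : v^T *m M = l *: v^T by rewrite -{1}MT -trmx_mul Mv linearZ.
have trQ B : \tr (Q *m B *m M) = \tr (B *m (M *m Q)) by rewrite -mulmxA mxtrace_mulC mulmxA.
have sk0 : \tr (Q *m skew u *m M) = 0.
  rewrite QE mulNmx mulNmx mulmxBl mulmxBl mul1mx !linearN/= linearB/= mxtrace_sym_skew//.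
  rewrite sub0r opprK -!scalemxAl linearZ/= -!mulmxA mxtrace_mulC -!mulmxA.
  have -> : v^T *m (skew u *m (M *m v)) = l *: (v^T *m (skew u *m v)).
    by rewrite Mv -!scalemxAr.
  by rewrite linearZ/= [\tr _]trace_mx11 [_ 0 0]dot_skew !mulr0.
have -> : \tr ((1%:M - Q) *m M) - \tr ((1%:M - Q *m angle_axis theta u) *m M) =
   \tr (Q *m angle_axis theta u *m M) - \tr (Q *m M).
  rewrite !mulmxBl !linearB/=; lra.
rewrite /angle_axis skew_sqr u1 !mulmxDr mulmx1 -!scalemxAr !mulmxDl -!scalemxAl.
rewrite !linearD/= !linearZ/= sk0 mulmxN mulmx1 mulmxBl linearB/= trQ.
have -> : \tr (u *m u^T *m (M *m Q)) = (u^T *m (M *m Q) *m u) 0 0.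
  by rewrite -mulmxA mxtrace_mulC trace_mx11.
have -> : \tr (Q *m M) = \tr (M *m Q) by rewrite mxtrace_mulC.
rewrite opprK linearN/= [in RHS]mxE.
have -> : (u^T *m (- \tr (M *m Q))%:M *m u) 0 0 = - \tr (M *m Q).
  by rewrite mul_mx_scalar -scalemxAl mxE [X in _ * X]u1 mulr1.
ring.
Qed.

End Rotations.

(** * Poses and measurements *)

Section Poses.
Context {R : realType}.
Implicit Types (A Q : 'M[R]_3) (v p q d : 'cV[R]_3).

Lemma pose_mul A Q v w p q :
  pose A v p *m pose Q w q = pose (A *m Q) (A *m w + v) (A *m q + p).
Proof.
rewrite /pose mulmx_block !mulmx0 !mul0mx !mulmx1 addr0 !add0r.
by rewrite mul_mx_row add_row_mx.
Qed.

Lemma pose1 : pose 1%:M 0 0 = 1%:M :> 'M[R]_(3 + (1 + 1)).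
Proof. by rewrite /pose row_mx0 -scalar_mx_block. Qed.

Lemma pose_inj A Q v w p q : pose A v p = pose Q w q -> A = Q.
Proof. by move=> /(congr1 ulsubmx); rewrite !block_mxKul. Qed.

Lemma pose_mulV Q v p : SO3 Q ->
  pose Q v p *m pose Q^T (- (Q^T *m v)) (- (Q^T *m p)) = 1%:M.
Proof.
move=> [QQ _]; rewrite pose_mul !mulmxN !mulmxA QQ !mul1mx !addNr; exact: pose1.
Qed.

Lemma pose_unit Q v p : SO3 Q -> pose Q v p \in unitmx.
Proof. by move=> SQ; have [] := mulmx1_unit (pose_mulV v p SQ). Qed.

Lemma invmx_pose Q v p : SO3 Q ->
  invmx (pose Q v p) = pose Q^T (- (Q^T *m v)) (- (Q^T *m p)).
Proof.
move=> SQ; rewrite -[LHS]mulmx1 -(pose_mulV v p SQ) mulmxA mulVmx ?pose_unit//.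
by rewrite mul1mx.
Qed.

Lemma invmx_mul m (A B : 'M[R]_m) : A \in unitmx -> B \in unitmx ->
  invmx (A *m B) = invmx B *m invmx A.
Proof.
move=> uA uB; have uAB : A *m B \in unitmx by rewrite unitmx_mul uA.
by rewrite -[RHS]mulmx1 -(mulmxV uAB) mulmxA -[_ *m (A *m B)]mulmxA mulKmx// mulVmx// mul1mx.
Qed.

Lemma SE23_unit X : SE23 X -> X \in @unitmx R _.
Proof. by move=> [Q [v [p [SQ ->]]]]; exact: pose_unit. Qed.

Lemma SO3_mul A Q : SO3 A -> SO3 Q -> SO3 (A *m Q).
Proof.
move=> [AA dA] [QQ dQ]; split; last by rewrite det_mulmx dA dQ mulr1.
by rewrite trmx_mul mulmxA -(mulmxA A) QQ mulmx1.
Qed.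

Lemma SO3_trmx Q : SO3 Q -> SO3 Q^T.
Proof.
by move=> SQ; split; [rewrite trmxK SO3_mulTmx|rewrite det_tr; case: SQ].
Qed.

Lemma sqnorm_col_mx d : sqnorm (col_mx d (0 : 'cV[R]_(1 + 1))) = sqnorm d.
Proof. by rewrite /sqnorm /dot tr_col_mx mul_row_col mulmx0 addr0. Qed.

Lemma dotBr m (x y z : 'cV[R]_m) : dot x (y - z) = dot x y - dot x z.
Proof. by rewrite /dot mulmxBr mxE; congr (_ + _); rewrite mxE. Qed.

Lemma trmx11 (A : 'M[R]_1) : A^T = A.
Proof. by apply/matrixP => i j; rewrite !ord1 mxE. Qed.

Lemma sqnorm_sub_rot Q d : SO3 Q -> sqnorm (d - Q *m d) = 2 * (sqnorm d - dot d (Q *m d)).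
Proof.
move=> SQ; rewrite /sqnorm /dot [(d - _)^T]linearB/= mulmxBl !mulmxBr.
have -> : (Q *m d)^T *m d = d^T *m (Q *m d).
  by rewrite -[LHS]trmx11 trmx_mul trmxK.
rewrite trmx_mul -[d^T *m Q^T *m _]mulmxA [Q^T *m _]mulmxA SO3_mulTmx// mul1mx.
by rewrite !mxE; lra.
Qed.
End Poses.

Section Measurements.
Context {R : realType} {n : nat}.
Variables (p : 'I_n -> 'cV[R]_3) (k : 'I_n -> R).
Hypothesis kc0 : k_c k != 0.
Local Notation M := (M_c p k).
Local Notation pc := (p_c p k).

Lemma M_c_sym : M^T = M.
Proof.
rewrite /M_c linear_sum/=; apply: eq_bigr => i _.
by rewrite linearZ/= trmx_mul trmxK.
Qed.

Lemma mxtrace_mul_M_c (A : 'M[R]_3) :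
  \tr (A *m M) = \sum_i k i * dot (p i - pc) (A *m (p i - pc)).
Proof.
rewrite /M_c mulmx_sumr linear_sum/=; apply: eq_bigr => i _.
by rewrite -scalemxAr linearZ/= mulmxA mxtrace_mulC trace_mx11.
Qed.

Lemma dot_M_c x : dot x (M *m x) = \sum_i k i * dot (p i - pc) x ^+ 2.
Proof.
rewrite /dot /M_c mulmx_suml mulmx_sumr summxE; apply: eq_bigr => i _.
rewrite -scalemxAl -scalemxAr mxE; congr (_ * _).
have -> : x^T *m ((p i - pc) *m (p i - pc)^T *m x) =
    (x^T *m (p i - pc)) *m ((p i - pc)^T *m x) by rewrite !mulmxA.
rewrite [LHS]mxE big_ord1 expr2; congr (_ * _).
by rewrite -[x^T *m _]trmx11 trmx_mul trmxK.
Qed.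

(** Lagrange's identity [|d|^2 |x|^2 - (d.x)^2 = |d x x|^2], summed over the centred landmarks
    [d]. *)
Lemma quad_M_c x : \tr M * sqnorm x - dot x (M *m x) =
  \sum_i k i * sqnorm (skew (p i - pc) *m x).
Proof.
have -> : \tr M = \sum_i k i * sqnorm (p i - pc).
  by rewrite -[M]mul1mx mxtrace_mul_M_c; apply: eq_bigr => i _; rewrite mul1mx.
rewrite dot_M_c mulr_suml -sumrB; apply: eq_bigr => i _.
rewrite -mulrA -mulrBr; congr (_ * _).
rewrite /sqnorm !dot3E !mulmx3E !skewE; ring.
Qed.

(** If the sum of squared cross products vanished, every landmark would lie on the line through the
    weighted centre with direction [x]. *)
Lemma quad_M_c_gt0 x : (forall i, 0 < k i) ->
  (exists i j l, ~ collinear [set y | [\/ y = p i, y = p j | y = p l]]) ->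
  x != 0 -> 0 < \tr M * sqnorm x - dot x (M *m x).
Proof.
move=> k0 [i [j [l ncol]]] x0.
have h m : true -> 0 <= k m * sqnorm (skew (p m - pc) *m x).
  by move=> _; rewrite mulr_ge0 ?sqnorm_ge0// ltW.
rewrite lt_neqAle quad_M_c sumr_ge0// andbT eq_sym; apply/eqP => s0.
apply: ncol; exists pc, x; split => // y yp.
have {yp}[m ->] : exists m, y = p m by case: yp => ->; eexists.
have /eqP := @psumr_eq0P _ _ predT _ h s0 m isT.
rewrite mulf_eq0 gt_eqF//= => /eqP /sqnorm_eq0 skew0.
have {skew0} : skew x *m (p m - pc) = 0.
  rewrite -[LHS]opprK -[RHS]oppr0 -skew0; congr (- _).
  apply/matrixP => a b; rewrite ord1 mxE.
  by elim/ord3_ind: a; rewrite !mulmx3E !skewE; ring.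
have sx0 : sqnorm x != 0 by apply: contra_neq x0; exact: sqnorm_eq0.
move=> /skew_mul_eq0 pmE; exists (dot x (p m - pc) / sqnorm x).
by rewrite mulrC -scalerA -pmE scalerA mulVf// scale1r addrC subrK.
Qed.

Lemma col_landmarks i :
  col i (landmarks p) = col_mx (p i) (col_mx 0 1%:M).
Proof. by apply/matrixP => a b; rewrite mxE /landmarks mxE ord1. Qed.

Lemma weighted_mean_landmarks :
  weighted_mean k (landmarks p) = col_mx pc (col_mx 0 1%:M).
Proof.
rewrite /weighted_mean.
have -> : \sum_i k i *: col i (landmarks p) =
    col_mx (\sum_i k i *: p i) (k_c k *: col_mx 0 1%:M).
  rewrite /k_c scaler_suml; under eq_bigr do rewrite col_landmarks scale_col_mx.
  elim/big_rec3 : _ => [|i x y z _ ->]; first by rewrite col_mx0.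
  by rewrite add_col_mx.
by rewrite scale_col_mx scalerA mulVf// scale1r.
Qed.

Lemma landmarks_centered i :
  col i (landmarks p) - weighted_mean k (landmarks p) = col_mx (p i - pc) 0.
Proof.
by rewrite col_landmarks weighted_mean_landmarks opp_col_mx add_col_mx subrr.
Qed.

Lemma weighted_mean_mul (A : 'M[R]_(3 + (1 + 1))) (y : 'M[R]_(3 + (1 + 1), n)) :
  weighted_mean k (A *m y) = A *m weighted_mean k y.
Proof.
rewrite /weighted_mean -scalemxAr mulmx_sumr; congr (_ *: _); apply: eq_bigr => i _.
by rewrite -scalemxAr !colE mulmxA.
Qed.

(** Centring removes the translation part, so only the rotation of [Y X^-1] matters. Each landmark
    contributes [|d - Q d|^2 = 2 (|d|^2 - d.Q d)], and the weighted sum is a trace against [M]. *)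
Lemma Upsilon_pose X Y Q v q : SO3 Q -> Y *m invmx X = pose Q v q ->
  Upsilon k Y (landmarks p) (invmx X *m landmarks p) = \tr ((1%:M - Q) *m M).
Proof.
move=> SQ YX; rewrite /Upsilon mxtrace_mul_M_c mulr_sumr; apply: eq_bigr => i _.
rewrite weighted_mean_mul.
have -> : col i (invmx X *m landmarks p) = invmx X *m col i (landmarks p).
  by rewrite !colE mulmxA.
rewrite -mulmxBr mulmxA YX landmarks_centered.
rewrite /pose mul_block_col !mulmx0 mul0mx !addr0 opp_col_mx add_col_mx subrr.
rewrite sqnorm_col_mx sqnorm_sub_rot// mulmxBl mul1mx dotBr -/(sqnorm _); lra.
Qed.

Lemma mxtrace_sub1_tr Q : \tr ((1%:M - Q^T) *m M) = \tr ((1%:M - Q) *m M).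
Proof.
rewrite -mxtrace_tr trmx_mul linearB/= trmx1 trmxK M_c_sym.
by rewrite mxtrace_mulC.
Qed.

(** The estimate times the inverse of the true pose has rotation [Rt^T], whose potential is that of
    [Rt] since [M] is symmetric. *)
Lemma Upsilon_measurements Xh Rt pe vt t : SE23 Xh -> SO3 Rt ->
  Upsilon k Xh (landmarks p) (measurements p k (Xh, Rt, pe, vt, t)) =
  \tr ((1%:M - Rt) *m M).
Proof.
move=> /SE23_unit uX SR; rewrite /measurements /= -mxtrace_sub1_tr.
set T := pose Rt _ _; have uT : T \in unitmx by exact: pose_unit.
apply: Upsilon_pose; first exact: SO3_trmx.
rewrite invmx_mul// mulmxA mulmxV// mul1mx; exact: invmx_pose.
Qed.

Lemma Upsilon_transformed Xh Rt pe vt t Rq vq pq : SE23 Xh -> SO3 Rt -> SO3 Rq ->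
  Upsilon k (invmx (pose Rq vq pq) *m Xh) (landmarks p)
    (measurements p k (Xh, Rt, pe, vt, t)) =
  \tr ((1%:M - Rt *m Rq) *m M).
Proof.
move=> /SE23_unit uX SR SRq; rewrite /measurements /= -mxtrace_sub1_tr.
set T := pose Rt _ _; have uT : T \in unitmx by exact: pose_unit.
have uq := pose_unit vq pq SRq.
apply: Upsilon_pose; first by apply/SO3_trmx/SO3_mul.
rewrite invmx_mul// mulmxA mulmxK// -invmx_mul// pose_mul.
by apply: invmx_pose; apply: SO3_mul.
Qed.

Variables (theta delta : R) (U : set 'cV[R]_3).
Hypothesis U1 : U `<=` @unit_sphere R.

Lemma Upsilon_ge0 X r b : (forall i, 0 <= k i) -> 0 <= Upsilon k X r b.
Proof.
move=> k0; rewrite mulr_ge0 ?invr_ge0//; apply: sumr_ge0 => i _.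
by rewrite mulr_ge0// sqnorm_ge0.
Qed.

Lemma flow_potential_drop Xh Rt pe vt t u : (forall i, 0 <= k i) ->
  SE23 Xh -> SO3 Rt -> U u ->
  mu k (transformations p k theta U) Xh (landmarks p)
    (measurements p k (Xh, Rt, pe, vt, t)) <= delta ->
  \tr ((1%:M - Rt) *m M) - \tr ((1%:M - Rt *m angle_axis theta u) *m M) <= delta.
Proof.
move=> k0 SX SR Uu; apply: le_trans.
rewrite /mu Upsilon_measurements// lerB//.
pose Xq := pose (angle_axis theta u) 0 ((1%:M - angle_axis theta u) *m pc).
rewrite -(@Upsilon_transformed Xh Rt pe vt t _ 0 ((1%:M - angle_axis theta u) *m pc))//; last first.
  exact/angle_axis_SO3/U1.
(* Nonnegativity of [Upsilon] bounds the set from below, so that its infimum is a genuine lower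
   bound and not a default value. *)
apply: ge_inf; last by exists Xq => //; exists u.
by exists 0 => _ [Y _ <-]; exact: Upsilon_ge0.
Qed.

Lemma jump_potential_drop Xh Rt pe vt t Rq vq pq : SE23 Xh -> SO3 Rt ->
  minimizers k (transformations p k theta U) Xh (landmarks p)
    (measurements p k (Xh, Rt, pe, vt, t)) (pose Rq vq pq) ->
  delta <= mu k (transformations p k theta U) Xh (landmarks p)
    (measurements p k (Xh, Rt, pe, vt, t)) ->
  SO3 Rq /\ \tr ((1%:M - Rt *m Rq) *m M) <= \tr ((1%:M - Rt) *m M) - delta.
Proof.
move=> SX SR [[u Uu /[dup] Xq /pose_inj Rqu] minq]; rewrite /mu Upsilon_measurements// => dmu.
have SRq : SO3 Rq by rewrite Rqu; exact/angle_axis_SO3/U1.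
split => //; rewrite lerBrDr -lerBrDl; apply: le_trans dmu _; rewrite lerB//.
rewrite -(@Upsilon_transformed Xh Rt pe vt t _ vq pq)//.
apply: lb_le_inf; last by move=> _ [Y QY <-]; exact: minq.
by eexists; exists (pose Rq vq pq) => //; exists u.
Qed.

End Measurements.

(** * Dissipation on the flow set *)

Section EntrywiseContinuity.
Context {R : realType} {T : topologicalType}.

(** Continuity is kept entrywise, so that matrix products and traces reduce to sums and products of
    real functions. *)
Definition mx_continuous m n (A : T -> 'M[R]_(m, n)) :=
  forall i j, continuous (fun x => A x i j).

Lemma continuous_sum_ord n (f : 'I_n -> T -> R) :
  (forall i, continuous (f i)) -> continuous (fun x => \sum_i f i x).
Proof.
move=> cf x; apply: (@cvg_big R^o _ +%R) => [|i _]; first exact: add_continuous.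
exact: cf.
Qed.

Lemma continuous_mul (f g : T -> R) :
  continuous f -> continuous g -> continuous (fun x => f x * g x).
Proof. by move=> cf cg x; apply: cvgM; [exact: cf|exact: cg]. Qed.

Lemma continuous_add (f g : T -> R) :
  continuous f -> continuous g -> continuous (fun x => f x + g x).
Proof. by move=> cf cg x; apply: cvgD; [exact: cf|exact: cg]. Qed.

Lemma continuous_sub (f g : T -> R) :
  continuous f -> continuous g -> continuous (fun x => f x - g x).
Proof. by move=> cf cg x; apply: cvgB; [exact: cf|exact: cg]. Qed.

Lemma continuous_cst (c : R) : continuous (fun _ : T => c).
Proof. by move=> x; exact: cvg_cst. Qed.

Lemma mx_continuous_cst m n (A : 'M[R]_(m, n)) : mx_continuous (fun=> A).
Proof. by move=> i j x; exact: cvg_cst. Qed.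

Lemma mx_continuousD m n (A B : T -> 'M[R]_(m, n)) :
  mx_continuous A -> mx_continuous B -> mx_continuous (fun x => A x + B x).
Proof.
move=> cA cB i j; rewrite (_ : (fun x => _) = (fun x => A x i j + B x i j)).
  by move=> x; apply: cvgD; [exact: cA|exact: cB].
by apply/funext => x; rewrite mxE.
Qed.

Lemma mx_continuousM m n q (A : T -> 'M[R]_(m, n)) (B : T -> 'M[R]_(n, q)) :
  mx_continuous A -> mx_continuous B -> mx_continuous (fun x => A x *m B x).
Proof.
move=> cA cB i j; rewrite (_ : (fun x => _) = (fun x => \sum_l A x i l * B x l j)).
  by apply: continuous_sum_ord => l x; apply: cvgM; [exact: cA|exact: cB].
by apply/funext => x; rewrite mxE.
Qed.

Lemma mx_continuousZ m n (f : T -> R) (A : T -> 'M[R]_(m, n)) :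
  continuous f -> mx_continuous A -> mx_continuous (fun x => f x *: A x).
Proof.
move=> cf cA i j; rewrite (_ : (fun x => _) = (fun x => f x * A x i j)).
  by move=> x; apply: cvgM; [exact: cf|exact: cA].
by apply/funext => x; rewrite mxE.
Qed.

Lemma mx_continuousN m n (A : T -> 'M[R]_(m, n)) :
  mx_continuous A -> mx_continuous (fun x => - A x).
Proof.
move=> cA i j; rewrite (_ : (fun x => _) = (fun x => - A x i j)).
  by move=> x; apply: cvgN; exact: cA.
by apply/funext => x; rewrite mxE.
Qed.

Lemma mx_continuous_tr m n (A : T -> 'M[R]_(m, n)) :
  mx_continuous A -> mx_continuous (fun x => (A x)^T).
Proof.
move=> cA i j; rewrite (_ : (fun x => _) = (fun x => A x j i)); first exact: cA.
by apply/funext => x; rewrite mxE.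
Qed.

Lemma continuous_mxtrace n (A : T -> 'M[R]_n) :
  mx_continuous A -> continuous (fun x => \tr (A x)).
Proof. by move=> cA; apply: continuous_sum_ord => i; exact: cA. Qed.

Lemma continuous_dot n (u v : T -> 'cV[R]_n) :
  mx_continuous u -> mx_continuous v -> continuous (fun x => dot (u x) (v x)).
Proof. by move=> cu cv; apply: (mx_continuousM (mx_continuous_tr cu) cv). Qed.

Lemma mx_continuous_skew (u : T -> 'cV[R]_3) :
  mx_continuous u -> mx_continuous (fun x => skew (u x)).
Proof.
move=> cu; have cN i : continuous (fun x => - u x i 0) by move=> x; apply: cvgN; exact: cu.
have c0 : continuous (fun _ : T => 0 : R) by move=> x; exact: cvg_cst.
by apply: ord3_ind; apply: ord3_ind; under eq_fun do rewrite skewE;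
  first [exact: c0 | exact: cu | exact: cN].
Qed.

Lemma mx_continuous_rotq (h : T -> R) (e : T -> 'cV[R]_3) :
  continuous h -> mx_continuous e -> mx_continuous (fun x => rotq (h x) (e x)).
Proof.
move=> ch ce; have cs := mx_continuous_skew ce.
apply: mx_continuousD; first apply: mx_continuousD.
- exact: mx_continuous_cst.
- by apply: mx_continuousZ => // x; apply: cvgM; [exact: cvg_cst|exact: ch].
- apply: mx_continuousZ; first by move=> x; exact: cvg_cst.
  exact: mx_continuousM.
Qed.

End EntrywiseContinuity.

(** * Lower bounds obtained by compactness *)

Section Compactness.
Context {R : realType}.

Lemma compact_pos_min n (K : set 'rV[R]_n) (f : 'rV[R]_n -> R) :
  closed K -> (forall x i, K x -> `|x 0 i| <= 1) -> continuous f ->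
  (forall x, K x -> 0 < f x) -> exists2 c, 0 < c & forall x, K x -> c <= f x.
Proof.
move=> clK bK cf f0; have [K0|/set0P K0] := eqVneq K set0.
  by exists 1 => // x; rewrite K0.
have cK : compact K.
  apply: bounded_closed_compact => //; exists 1; split => // y y1 x Kx.
  rewrite /= (le_trans _ (ltW y1))// [`|x|]/Num.norm/= mx_normrE.
  apply: bigmax_le => // -[i j] _ /=; rewrite ord1; exact: bK.
have [c cK' cmin] := EVT_min_rV K0 cK (continuous_subspaceT cf).
exists (f c); first by apply: f0; rewrite -inE.
by move=> x Kx; apply: cmin; rewrite inE.
Qed.

Lemma closed_preimage_eq (T : topologicalType) (f : T -> R) (a : R) :
  continuous f -> closed [set x | f x = a].
Proof. by move=> /continuous_closedP /(_ _ (@closed_eq _ a)). Qed.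

Lemma closed_preimage_le (T : topologicalType) (f : T -> R) (a : R) :
  continuous f -> closed [set x | f x <= a].
Proof. by move=> /continuous_closedP /(_ _ (@closed_le _ a)). Qed.

Lemma sqnorm_coord n (e : 'cV[R]_n) i : e i 0 ^+ 2 <= sqnorm e.
Proof.
rewrite /sqnorm /dot mxE (bigD1 i)//= mxE -expr2 lerDl.
by apply: sumr_ge0 => j _; rewrite mxE -expr2 sqr_ge0.
Qed.

Lemma sqnormZ n (s : R) (e : 'cV[R]_n) : sqnorm (s *: e) = s ^+ 2 * sqnorm e.
Proof.
by rewrite /sqnorm /dot [(s *: e)^T]linearZ/= -scalemxAl -scalemxAr scalerA mxE expr2.
Qed.

Lemma dotZZ n (s : R) (e f : 'cV[R]_n) : dot (s *: e) (s *: f) = s ^+ 2 * dot e f.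
Proof.
by rewrite /dot [(s *: e)^T]linearZ/= -scalemxAl -scalemxAr scalerA mxE expr2.
Qed.

Variables (M : 'M[R]_3).
Hypothesis MT : M^T = M.
Hypothesis quad_gt0 : forall x, x != 0 -> 0 < \tr M * sqnorm x - dot x (M *m x).
Hypothesis M_ge0 : forall x, 0 <= dot x (M *m x).

Local Notation pot Q := (\tr ((1%:M - Q) *m M)).

(** Both sides are homogeneous of degree two, so the minimum over the unit sphere gives the
    constant. *)
Lemma quad_lower_bound : exists2 m, 0 < m &
  forall x, m * sqnorm x <= \tr M * sqnorm x - dot x (M *m x).
Proof.
pose K : set 'rV[R]_3 := [set x | sqnorm x^T = 1].
have cT : mx_continuous (fun x : 'rV[R]_3 => x^T).
  by apply: mx_continuous_tr => i j; exact: coord_continuous.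
have cMT : mx_continuous (fun x : 'rV[R]_3 => M *m x^T).
  by apply: mx_continuousM => //; exact: mx_continuous_cst.
have [||||m m0 hm] := @compact_pos_min _ K
    (fun x => \tr M * sqnorm x^T - dot x^T (M *m x^T)).
- exact/closed_preimage_eq/continuous_dot.
- move=> x i Kx; rewrite -(@ler_pXn2r _ 2) ?nnegrE// expr1n.
  by rewrite real_normK ?num_real// -Kx (le_trans _ (sqnorm_coord _ i))// mxE.
- apply: continuous_sub; last exact: continuous_dot.
  by apply: continuous_mul; [exact: continuous_cst|exact: continuous_dot].
- move=> x Kx; apply: quad_gt0; apply: contra_eq_neq Kx => /= ->.
  by rewrite /sqnorm /dot mulmx0 mxE eq_sym oner_eq0.
exists m => // x; have [->|x0] := eqVneq x 0.
  by rewrite /sqnorm /dot !mulmx0 !mxE !mulr0 subrr.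
have sx : 0 < sqnorm x.
  by rewrite lt_neqAle sqnorm_ge0 andbT eq_sym; apply: contra_neq x0; exact: sqnorm_eq0.
pose s := Num.sqrt (sqnorm x).
have s0 : s != 0 by rewrite gt_eqF ?sqrtr_gt0.
have s2 : s ^+ 2 = sqnorm x by rewrite sqr_sqrtr// ltW.
have xE : x = s *: (s^-1 *: x) by rewrite scalerA mulfV// scale1r.
have ye : sqnorm (s^-1 *: x) = 1 by rewrite sqnormZ -s2 exprVn mulVf// expf_neq0.
have := hm (s^-1 *: x)^T; rewrite /K/= trmxK ye => /(_ erefl).
set y := s^-1 *: x in xE ye * => {}hm.
rewrite xE -scalemxAr sqnormZ dotZZ ye.
have := ler_wpM2l (sqr_ge0 s) hm; lra.
Qed.

Lemma SO3_potential_bounds : exists m1 m2, [/\ 0 < m1, 0 < m2 &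
  forall Q, SO3 Q -> m1 * sqnorm_rot Q <= pot Q <= m2 * sqnorm_rot Q].
Proof.
have [m m0 hm] := quad_lower_bound.
(* In quaternions the potential is twice the quadratic form at [e], and [|Q|_I^2 = |e|^2]. The trace
   bounds the form from above; adding [2 * m] makes the constant visibly positive. *)
exists (2 * m), (2 * m + 2 * \tr M).
have trM : 0 <= \tr M.
  pose e : 'cV[R]_3 := delta_mx 0 0.
  have e1 : sqnorm e = 1 by rewrite /sqnorm dot3E !mxE/=; ring.
  by have := hm e; have := M_ge0 e; rewrite e1; lra.
split => [||Q /SO3_rotq[h [e [he ->]]]]; [lra|lra|].
rewrite mxtrace_rotq// sqnorm_rot_rotq.
have := hm e; have := M_ge0 e; have := sqnorm_ge0 e => se.
have := mulr_ge0 (ltW m0) se; lra.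
Qed.

Lemma sqnorm_rot_le1 (Q : 'M[R]_3) : SO3 Q -> sqnorm_rot Q <= 1.
Proof.
by move=> /SO3_rotq[h [e [he ->]]]; rewrite sqnorm_rot_rotq -he lerDr sqr_ge0.
Qed.

Variables (theta delta : R) (U : set 'cV[R]_3).
Hypothesis U1 : U `<=` @unit_sphere R.
Hypothesis U0 : U !=set0.
Hypothesis delta_gt0 : 0 < delta.
Hypothesis delta_lt : delta < (1 - cos theta) * gap M U.

(** Otherwise every axis gives at most [delta / (1 - cos theta)] at [v], and hence so does [gap],
    against the choice of [delta]. The bounds of the potential over SO(3) show that the suprema and
    the infimum in [gap] are taken over bounded sets. *)
Lemma half_turn_exits_flow_set v l : sqnorm v = 1 -> M *m v = l *: v ->
  exists2 u, U u & delta < pot (rotq 0 v) - pot (rotq 0 v *m angle_axis theta u).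
Proof.
move=> v1 Mv.
(* If [cos theta] were 1, the bound on [delta] would read [delta < 0]. *)
have cos1 : 0 < 1 - cos theta.
  rewrite lt_neqAle subr_ge0 cos_le1 andbT; apply/eqP => c0.
  by move: delta_lt; rewrite -c0 mul0r ltNge ltW.
apply: contrapT => noU.
have {}noU u : U u -> pot (rotq 0 v) - pot (rotq 0 v *m angle_axis theta u) <= delta.
  by move=> Uu; rewrite leNgt; apply/negP => du; apply: noU; exists u.
pose val (v u : 'cV[R]_3) := (u^T *m ((\tr (M *m (1%:M - 2 *: (v *m v^T))))%:M
                             - M *m (1%:M - 2 *: (v *m v^T))) *m u) 0 0.
have valE w u k : sqnorm w = 1 -> M *m w = k *: w -> U u ->
    val w u = (pot (rotq 0 w) - pot (rotq 0 w *m angle_axis theta u)) / (1 - cos theta).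
  move=> w1 Mw Uu; have u1 : sqnorm u = 1 by exact: U1.
  by rewrite (mxtrace_half_turn _ MT w1 u1 Mw) mulrAC divff ?mul1r// gt_eqF.
have [m1 [m2 [m10 m20 potb]]] := SO3_potential_bounds.
have pot01 Q : SO3 Q -> 0 <= pot Q <= m2.
  move=> SQ; have /andP[h1 h2] := potb _ SQ; have r0 := sqnorm_rot_ge0 SQ.
  have r1 := sqnorm_rot_le1 SQ.
  have := mulr_ge0 (ltW m10) r0; have := ler_wpM2l (ltW m20) r1; lra.
have rot0 (w : 'cV[R]_3) : sqnorm w = 1 -> SO3 (rotq 0 w).
  by move=> w1; apply: rotq_SO3; rewrite w1 expr0n add0r.
have valb w u k : sqnorm w = 1 -> M *m w = k *: w -> U u ->
    - m2 / (1 - cos theta) <= val w u <= m2 / (1 - cos theta).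
  move=> w1 Mw Uu; rewrite (valE _ _ _ w1 Mw Uu).
  have /andP[h1 h2] := pot01 _ (rot0 _ w1).
  have /andP[h3 h4] := pot01 _ (SO3_mul (rot0 _ w1) (angle_axis_SO3 theta (U1 Uu))).
  by rewrite !ler_pM2r ?invr_gt0//; lra.
have : gap M U <= delta / (1 - cos theta).
  rewrite /gap; apply: (@le_trans _ _ (sup [set val v u | u in U])); last first.
    apply: ge_sup; first by case: U0 => u Uu; exists (val v u); exists u.
    by move=> _ [u Uu <-]; rewrite (valE _ _ _ v1 Mv Uu) ler_pM2r ?invr_gt0// noU.
  apply: ge_inf; last by exists v => //; split => //; exists l.
  exists (- m2 / (1 - cos theta)) => _ [w [w1 [k Mw]] <-].
  have [u0 Uu0] := U0; have /andP[lb _] := valb _ _ _ w1 Mw Uu0.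
  apply: le_trans lb _; apply: ub_le_sup; last by exists u0.
  by exists (m2 / (1 - cos theta)) => _ [u Uu <-]; have /andP[] := valb _ _ _ w1 Mw Uu.
rewrite ler_pdivlMr// mulrC => gd.
by move: delta_lt; rewrite ltNge gd.
Qed.

(* Quaternions are written [(h, s e)] with [e] a unit vector, so that the factor
   [s^2 = |s e|^2], which vanishes at the identity, can be divided out before
   compactness is used. *)
Lemma flow_dissipation : exists2 c, 0 < c & forall Q, SO3 Q ->
  (forall u, U u -> pot Q - pot (Q *m angle_axis theta u) <= delta) ->
  c * sqnorm_rot Q <= - \tr (skew_part (M *m Q) *m (M *m Q)).
Proof.
pose h (x : 'rV[R]_(2 + 3)) := x 0 (lshift 3 0).
pose s (x : 'rV[R]_(2 + 3)) := x 0 (lshift 3 1).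
pose e (x : 'rV[R]_(2 + 3)) : 'cV[R]_3 := (rsubmx x)^T.
have ch : continuous h by exact: coord_continuous.
have cs : continuous s by exact: coord_continuous.
have ce : mx_continuous e.
  apply: mx_continuous_tr => i j.
  rewrite (_ : (fun x => _) = (fun x : 'rV[R]_(2 + 3) => x i (rshift 2 j))).
    exact: coord_continuous.
  by apply/funext => x; rewrite mxE.
pose q x := rotq (h x) (s x *: e x).
have cq : mx_continuous q.
  by apply: mx_continuous_rotq => //; apply: mx_continuousZ.
have cpot (A : 'rV[R]_(2 + 3) -> 'M[R]_3) :
    mx_continuous A -> continuous (fun x => pot (A x)).
  move=> cA; apply: continuous_mxtrace; apply: mx_continuousM; last exact: mx_continuous_cst.
  apply: mx_continuousD; first exact: mx_continuous_cst.
  exact: mx_continuousN.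
have cX (f : 'rV[R]_(2 + 3) -> R) : continuous f -> continuous (fun x => f x ^+ 2).
  by move=> cf; apply: continuous_mul.
pose K : set 'rV[R]_(2 + 3) :=
  [set x | h x ^+ 2 + s x ^+ 2 = 1] `&` [set x | sqnorm (e x) = 1] `&`
  \bigcap_(u in U) [set x | pot (q x) - pot (q x *m angle_axis theta u) <= delta].
(* The dissipation at [q x] with the factor [s^2] divided out. *)
pose F x := 2 * (h x ^+ 2 * sqnorm (\tr M *: e x - M *m e x)
                 + s x ^+ 2 * sqnorm (skew (e x) *m (M *m e x))).
have cMe : mx_continuous (fun x => M *m e x).
  by apply: mx_continuousM => //; exact: mx_continuous_cst.
have [||||c c0 hc] := @compact_pos_min _ K F.
- apply: closedI; first apply: closedI.
  + apply: closed_preimage_eq; apply: continuous_add; exact: cX.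
  + exact/closed_preimage_eq/continuous_dot.
  + apply: closed_bigI => u _; apply: closed_preimage_le; apply: continuous_sub.
      exact: cpot.
    apply: (cpot (fun x => q x *m angle_axis theta u)).
    by apply: mx_continuousM => //; exact: mx_continuous_cst.
- move=> x i [[/= hs1 e1] _]; rewrite -(@ler_pXn2r _ 2) ?nnegrE// expr1n.
  rewrite real_normK ?num_real//; rewrite -(fintype.splitK i); case: (fintype.split i) => j /=.
    rewrite -hs1; case: j => [[|[|//]] j2].
      by rewrite (_ : Ordinal j2 = 0) ?lerDl ?sqr_ge0//; exact: val_inj.
    by rewrite (_ : Ordinal j2 = 1) ?lerDr ?sqr_ge0//; exact: val_inj.
  by rewrite -e1 (le_trans _ (sqnorm_coord _ j))// !mxE.
- apply: continuous_mul; first exact: continuous_cst.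
  apply: continuous_add; apply: continuous_mul; first exact: cX.
  + apply: (@continuous_dot _ _ _ (fun x => \tr M *: e x - M *m e x)
               (fun x => \tr M *: e x - M *m e x));
    by apply: mx_continuousD; [by apply: mx_continuousZ => //; exact: continuous_cst
                              |exact: mx_continuousN].
  + exact: cX.
  + have cc : mx_continuous (fun x => skew (e x) *m (M *m e x)).
      by apply: mx_continuousM => //; exact: mx_continuous_skew.
    exact: continuous_dot.
- move=> x [[/= hs1 e1] Ux]; rewrite lt_neqAle eq_sym.
  have A0 : 0 <= h x ^+ 2 * sqnorm (\tr M *: e x - M *m e x).
    by rewrite mulr_ge0 ?sqr_ge0 ?sqnorm_ge0.
  have B0 : 0 <= s x ^+ 2 * sqnorm (skew (e x) *m (M *m e x)).
    by rewrite mulr_ge0 ?sqr_ge0 ?sqnorm_ge0.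
  rewrite mulr_ge0 ?addr_ge0// andbT; apply/eqP => /eqP.
  rewrite mulf_eq0 pnatr_eq0/= paddr_eq0// => /andP[].
  (* At a zero of [F], the vector [(tr(M) I - M) e] is nonzero, which forces [h = 0]; then [s^2 = 1]
     and [e] is an eigenvector, so [q x] is a half-turn, excluded from the flow set. *)
  rewrite mulf_eq0 sqrf_eq0 => hz; rewrite mulf_eq0 sqrf_eq0 => sz.
  have e0 : e x != 0.
    by apply: contra_eq_neq e1 => ->; rewrite /sqnorm /dot mulmx0 mxE eq_sym oner_eq0.
  have W0 : sqnorm (\tr M *: e x - M *m e x) != 0.
    apply/eqP => /sqnorm_eq0 W0; have := quad_gt0 e0.
    have -> : \tr M * sqnorm (e x) - dot (e x) (M *m e x) =
        dot (e x) (\tr M *: e x - M *m e x).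
      by rewrite dotBr; congr (_ - _); rewrite /dot -scalemxAr mxE.
    by rewrite W0 /dot mulmx0 mxE ltxx.
  move: hz; rewrite (negbTE W0) orbF => /eqP h0.
  have s1 : s x ^+ 2 = 1 by rewrite -hs1 h0 expr0n add0r.
  have /eqP/sqnorm_eq0/skew_mul_eq0 : sqnorm (skew (e x) *m (M *m e x)) == 0.
    by case/orP: sz => [/eqP s0|//]; move: s1; rewrite s0 expr0n => /eqP; rewrite eq_sym oner_eq0.
  rewrite e1 scale1r => Me.
  have v1 : sqnorm (s x *: e x) = 1 by rewrite sqnormZ s1 e1 mulr1.
  have Mv : M *m (s x *: e x) = dot (e x) (M *m e x) *: (s x *: e x).
    by rewrite -scalemxAr {1}Me !scalerA mulrC.
  have [u Uu] := half_turn_exits_flow_set v1 Mv.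
  have := Ux u Uu; rewrite /= /q h0 => /le_lt_trans/[apply].
  by rewrite ltxx.
exists c => // Q /SO3_rotq[h1 [e1 [he ->]]] hU.
rewrite mxtrace_skew_part_rotq// sqnorm_rot_rotq.
(* A zero vector part cannot be normalised, but then the rotation error vanishes and nonnegativity
   suffices. *)
have [e10|e10] := eqVneq e1 0.
  have -> : sqnorm e1 = 0 by rewrite e10 /sqnorm /dot mulmx0 mxE.
  rewrite mulr0; apply: mulr_ge0 => //.
  by rewrite addr_ge0 ?sqnorm_ge0// mulr_ge0 ?sqr_ge0 ?sqnorm_ge0.
have se : 0 < sqnorm e1.
  by rewrite lt_neqAle sqnorm_ge0 andbT eq_sym; apply: contra_neq e10; exact: sqnorm_eq0.
pose s1 := Num.sqrt (sqnorm e1).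
have s0 : s1 != 0 by rewrite gt_eqF ?sqrtr_gt0.
have s2 : s1 ^+ 2 = sqnorm e1 by rewrite sqr_sqrtr// ltW.
pose y := s1^-1 *: e1.
have eE : e1 = s1 *: y by rewrite scalerA mulfV// scale1r.
have y1 : sqnorm y = 1 by rewrite sqnormZ -s2 exprVn mulVf// expf_neq0.
clearbody y.
pose x : 'rV[R]_(2 + 3) := row_mx (\row_i [:: h1; s1]`_i) y^T.
have hx : h x = h1 by rewrite /h /x row_mxEl mxE.
have sx : s x = s1 by rewrite /s /x row_mxEl mxE.
have ex : e x = y by rewrite /e /x row_mxKr trmxK.
have Kx : K x.
  split; first split => /=.
  - by rewrite hx sx s2.
  - by rewrite ex.
  - by move=> u Uu; rewrite /= /q hx sx ex -eE; exact: hU.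
have := hc x Kx; rewrite /F hx sx ex => {}hc.
have -> : \tr M *: e1 - M *m e1 = s1 *: (\tr M *: y - M *m y).
  by rewrite [in LHS]eE scalerBr !scalerA mulrC -scalemxAr.
have -> : skew e1 *m (M *m e1) = s1 ^+ 2 *: (skew y *m (M *m y)).
  have -> : skew e1 = s1 *: skew y.
    by rewrite eE; mx3; rewrite [RHS]mxE !skewE ?mxE; ring.
  by rewrite {1}eE -!scalemxAr -scalemxAl !scalerA expr2.
rewrite !sqnormZ -s2; have := ler_wpM2l (sqr_ge0 s1) hc; lra.
Qed.

End Compactness.

(** * A strict Lyapunov function for the coupled errors *)

Section Lyapunov.
Context {R : realType}.
Implicit Types (x y z : 'cV[R]_3).

(** In quaternions the left-hand side is [4 (|e|^2 |x|^2 - (e.x)^2)]. It bounds the input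
    [(I - Q) g] of the velocity error by the rotation error. *)
Lemma sqnorm_sub1_rot (Q : 'M[R]_3) x : SO3 Q ->
  sqnorm ((1%:M - Q) *m x) <= 4 * sqnorm x * sqnorm_rot Q.
Proof.
move=> SQ; rewrite mulmxBl mul1mx sqnorm_sub_rot//.
have [h [e [he ->]]] := SO3_rotq SQ; rewrite sqnorm_rot_rotq.
have -> : sqnorm x - dot x (rotq h e *m x) = 2 * (sqnorm e * sqnorm x - dot e x ^+ 2).
  by rewrite /sqnorm !dot3E !mulmx3E !rotqE; ring.
have := sqr_ge0 (dot e x); lra.
Qed.

Lemma dotC m (x y : 'cV[R]_m) : dot x y = dot y x.
Proof. by rewrite /dot -[x^T *m y]trmx11 trmx_mul trmxK. Qed.

Lemma dot_young x y (t : R) : 0 < t -> 2 * dot x y <= t * sqnorm x + t^-1 * sqnorm y.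
Proof.
move=> t0; have := sqnorm_ge0 (x - t^-1 *: y).
have -> : sqnorm (x - t^-1 *: y) = sqnorm x - 2 * t^-1 * dot x y + t^-1 ^+ 2 * sqnorm y.
  by rewrite /sqnorm !dot3E !mxE; ring.
move=> /(mulr_ge0 (ltW t0)).
have -> : t * (sqnorm x - 2 * t^-1 * dot x y + t^-1 ^+ 2 * sqnorm y) =
  t * sqnorm x - 2 * dot x y + t^-1 * sqnorm y by field; rewrite gt_eqF.
lra.
Qed.

(** The form [b |x|^2 + |y|^2] alone dissipates only in [x]; the cross term [- 2 eps x.y] adds
    dissipation in [y], and is small enough to keep the form definite. The input [d] is absorbed by
    the decay of [gam V]. *)
Lemma lyapunov_constants (a b k D m1 m2 : R) :
  0 < a -> 0 < b -> 0 < k -> 0 <= D -> 0 < m1 -> 0 < m2 ->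
  exists eps gam lam q1 q2,
    [/\ 0 <= gam, 0 < lam, 0 < q1, 0 < q2 &
    forall (x y d : 'cV[R]_3) (r V V' : R), 0 <= r -> sqnorm d <= D * r ->
      m1 * r <= V <= m2 * r -> V' <= - k * r ->
      let L := b * sqnorm x + sqnorm y - 2 * eps * dot x y + gam * V in
      [/\ q1 * (r + sqnorm x + sqnorm y) <= L,
          L <= q2 * (r + sqnorm x + sqnorm y) &
          2 * b * dot x (- a *: x + y) + 2 * dot y (- b *: x + d)
          - 2 * eps * (dot (- a *: x + y) y + dot x (- b *: x + d))
          + gam * V' <= - lam * L]].
Proof.
move=> a0 b0 k0 D0 m10 m20.
(* The terms of order [e |x|^2] come from the cross term ([2 b]) and from Young's inequality
   ([2 a^2] and 1); [e * w <= a * b] leaves half of the dissipation [2 a b |x|^2]. *)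
pose w := 2 * b + 2 * a ^+ 2 + 1.
have w0 : 0 < w by rewrite /w; have := sqr_ge0 a; lra.
pose e := Num.min (Num.min (b / 2) (2^-1)) (a * b / w).
have ab0 : 0 < a * b by rewrite mulr_gt0.
have e0 : 0 < e by rewrite !lt_min invr_gt0 ltr0n !divr_gt0.
have eb : e <= b / 2 by rewrite !ge_min lexx.
have e1 : e <= 2^-1 by rewrite !ge_min lexx orbT.
have ew : e * w <= a * b by rewrite -ler_pdivlMr// !ge_min lexx !orbT.
clearbody e.
(* [C] is the total coefficient of [|d|^2] after Young's inequalities, and [gam] makes [gam * k]
   exceed [C * D] by 1, which leaves the dissipation [- r]. *)
pose C := 2 / e + e.
have C0 : 0 < C by rewrite addr_gt0// divr_gt0.
pose gam := (C * D + 1) / k.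
have CD0 : 0 <= C * D by rewrite mulr_ge0// ltW.
have gam0 : 0 < gam by rewrite divr_gt0//; lra.
have gamk : gam * k = C * D + 1 by rewrite divfK// gt_eqF.
clearbody gam.
pose q1 := Num.min 2^-1 (Num.min (b / 2) (gam * m1)).
have q10 : 0 < q1.
  by rewrite !lt_min invr_gt0 ltr0n (divr_gt0 b0)?ltr0n// mulr_gt0.
pose q2 := b + 2 + gam * m2.
have gm2 : 0 < gam * m2 by rewrite mulr_gt0.
have q20 : 0 < q2 by rewrite /q2; lra.
pose q3 := Num.min 1 (Num.min (a * b) e).
have q30 : 0 < q3 by rewrite !lt_min ltr01 ab0.
exists e, gam, (q3 / q2), q1, q2; split => //; [exact: ltW|exact: divr_gt0|].
move=> x y d r V V' r0 dr /andP[V1 V2] hV' L.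
have X0 := sqnorm_ge0 x; have Y0 := sqnorm_ge0 y; have d0 := sqnorm_ge0 d.
have xy1 := dot_young x y ltr01.
have xy2 := dot_young (- x) y ltr01.
have sN z : sqnorm (- z) = sqnorm z by rewrite /sqnorm !dot3E !mxE; ring.
have dN z z' : dot (- z) z' = - dot z z' by rewrite !dot3E !mxE; ring.
rewrite invr1 !mul1r in xy1; rewrite invr1 !mul1r sN dN in xy2.
have exy1 := ler_wpM2l (ltW e0) xy1; have exy2 := ler_wpM2l (ltW e0) xy2.
have gV1 := ler_wpM2l (ltW gam0) V1; have gV2 := ler_wpM2l (ltW gam0) V2.
have qr (q c s : R) : q <= c -> 0 <= s -> q * s <= c * s by move=> qc s0; rewrite ler_wpM2r.
have Llow : q1 * (r + sqnorm x + sqnorm y) <= L.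
  have h1 : q1 * r <= gam * m1 * r by apply: qr => //; rewrite !ge_min lexx !orbT.
  have h2 : q1 * sqnorm x <= b / 2 * sqnorm x by apply: qr => //; rewrite !ge_min lexx !orbT.
  have h3 : q1 * sqnorm y <= 2^-1 * sqnorm y by apply: qr => //; rewrite !ge_min lexx.
  have h4 := qr _ _ _ eb X0; have h5 := qr _ _ _ e1 Y0.
  rewrite /L; lra.
have Lup : L <= q2 * (r + sqnorm x + sqnorm y).
  have h4 := qr _ _ _ eb X0; have h5 := qr _ _ _ e1 Y0.
  have h6 := mulr_ge0 (ltW gm2) X0; have h7 := mulr_ge0 (ltW gm2) Y0.
  have h8 := mulr_ge0 (ltW b0) Y0; have h9 := mulr_ge0 (ltW b0) r0.
  have h10 := mulr_ge0 (ltW b0) X0.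
  have h11 := qr _ _ _ e1 X0.
  rewrite /L /q2; lra.
split => //.
have decay : 2 * b * dot x (- a *: x + y) + 2 * dot y (- b *: x + d)
    - 2 * e * (dot (- a *: x + y) y + dot x (- b *: x + d)) + gam * V'
    <= - q3 * (r + sqnorm x + sqnorm y).
  have -> : 2 * b * dot x (- a *: x + y) + 2 * dot y (- b *: x + d)
    - 2 * e * (dot (- a *: x + y) y + dot x (- b *: x + d)) =
    - 2 * (a * b) * sqnorm x + 2 * b * (e * sqnorm x) - 2 * (e * sqnorm y)
    + e * (2 * (a * dot x y)) + 2 * dot y d - e * (2 * dot x d).
    by rewrite /sqnorm !dot3E !mxE; ring.
  have y1 : e * (2 * (a * dot x y)) <= e * (2 * a ^+ 2 * sqnorm x + 2^-1 * sqnorm y).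
    rewrite ler_pM2l//; have := dot_young (a *: x) y (ltr0n R 2).
    have -> : dot (a *: x) y = a * dot x y by rewrite !dot3E !mxE; ring.
    by rewrite sqnormZ; lra.
  have y2 : 2 * dot y d <= e / 2 * sqnorm y + 2 / e * sqnorm d.
    have := dot_young y d (_ : 0 < e / 2); rewrite invf_div; apply.
    by rewrite divr_gt0.
  have y3 : - (e * (2 * dot x d)) <= e * sqnorm x + e * sqnorm d.
    have := dot_young (- x) d ltr01; rewrite invr1 !mul1r sN dN => h.
    have := ler_wpM2l (ltW e0) h; lra.
  have y4 : C * sqnorm d <= C * D * r by rewrite -mulrA ler_pM2l.
  have y5 : gam * V' <= - (C * D + 1) * r.
    by have := ler_wpM2l (ltW gam0) hV'; rewrite -gamk; lra.
  have y6 := qr _ _ _ ew X0.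
  have h1 : q3 * r <= 1 * r by apply: qr => //; rewrite !ge_min lexx.
  have h2 : q3 * sqnorm x <= a * b * sqnorm x by apply: qr => //; rewrite !ge_min lexx !orbT.
  have h3 : q3 * sqnorm y <= e * sqnorm y by apply: qr => //; rewrite !ge_min lexx !orbT.
  rewrite /w in y6; rewrite /C in y4 y5; lra.
apply: (le_trans decay); rewrite !mulNr lerN2 mulrAC ler_pdivrMr//.
by rewrite -mulrA ler_pM2l// mulrC.
Qed.

End Lyapunov.

(** * Hybrid trajectories *)

Lemma mx_coord_le (R : realType) m n (A : 'M[R]_(m, n)) i j : `|A i j| <= `|A|.
Proof.
rewrite [leRHS]/Num.norm/= mx_normrE.
by apply/bigmax_geP; right; exists (i, j).
Qed.

Lemma norm_fst_le (R : realType) (V W : normedModType R) (x : V * W) : `|x.1| <= `|x|.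
Proof. by rewrite [leRHS]/Num.norm/= le_max lexx. Qed.

Lemma norm_snd_le (R : realType) (V W : normedModType R) (x : V * W) : `|x.2| <= `|x|.
Proof. by rewrite [leRHS]/Num.norm/= le_max lexx orbT. Qed.

Lemma is_derive_dot (R : realType) (f h : R -> 'cV[R]_3) (df dh : 'cV[R]_3) (t : R) :
  (forall i, is_derive t 1 (fun s => f s i 0) (df i 0)) ->
  (forall i, is_derive t 1 (fun s => h s i 0) (dh i 0)) ->
  is_derive t 1 (fun s => dot (f s) (h s)) (dot df (h t) + dot (f t) dh).
Proof.
move=> Df Dh; have D i := is_deriveM (Df i) (Dh i).
have := is_deriveD (is_deriveD (D 0) (D 1)) (D 2).
rewrite (_ : (fun s => dot _ _) = ((fun s => f s 0 0) * (fun s => h s 0 0) +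
   (fun s => f s 1 0) * (fun s => h s 1 0) + (fun s => f s 2 0) * (fun s => h s 2 0))).
  by move=> /is_derive_eq; apply; rewrite !dot3E /GRing.scale/=; ring.
by apply/funext => s; rewrite dot3E.
Qed.

Lemma ac_dot (R : realType) (a b : R) n (f h : R -> 'cV[R]_n) :
  (forall i, absolutely_continuous a b (fun s => f s i 0)) ->
  (forall i, absolutely_continuous a b (fun s => h s i 0)) ->
  absolutely_continuous a b (fun s => dot (f s) (h s)).
Proof.
move=> acf ach; rewrite (_ : (fun s => _) = (fun s => \sum_i f s i 0 * h s i 0)).
  by apply: ac_sum => i; exact: acM.
by apply/funext => s; rewrite /dot mxE; apply: eq_bigr => i _; rewrite mxE.
Qed.

(** * Structure of hybrid time domains *)

Section HybridTimeDomains.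
Context {R : realType}.
Implicit Types (E : set (R * nat)).

(** The form suited to induction along a trajectory: [J] flow intervals, each ended by a jump, then
    a last flow up to [T]. *)
Lemma hybrid_time_domain_jumps E T J : hybrid_time_domain E -> E (T, J) ->
  exists s : nat -> R, [/\ s 0%N = 0,
    (forall i, (i < J)%N -> s i <= s i.+1 /\ E (s i.+1, i.+1)),
    s J <= T,
    (forall i t, (i < J)%N -> s i <= t <= s i.+1 -> E (t, i)) &
    (forall t, s J <= t <= T -> E (t, J))].
Proof.
move=> [E0 _ /(_ T J) hE] ETJ; have [J' [s [s0 smono sE]]] := hE ETJ.
have T0 : 0 <= T := E0 _ ETJ.
have ETJ' : (E `&` [set tj | 0 <= tj.1 <= T /\ (tj.2 <= J)%N]) (T, J).
  by split => //=; rewrite T0 lexx.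
have [/= JJ' /andP[sJT TsJ]] :
    [set tj : R * nat | (tj.2 <= J')%N /\ s tj.2 <= tj.1 <= s tj.2.+1] (T, J).
  by rewrite -sE.
have inE' t i : (i <= J')%N -> s i <= t <= s i.+1 -> E (t, i).
  move=> iJ' ti.
  have : [set tj : R * nat | (tj.2 <= J')%N /\ s tj.2 <= tj.1 <= s tj.2.+1] (t, i) by [].
  by rewrite -sE => -[].
exists s; split => //.
- move=> i iJ; have iJ' : (i.+1 <= J')%N := leq_trans iJ JJ'.
  by split; [exact/smono/ltnW|apply: inE' => //; rewrite lexx smono].
- by move=> i t iJ; apply: inE'; exact: leq_trans (ltnW iJ) JJ'.
- by move=> t /andP[st tT]; apply: inE' => //; rewrite st (le_trans tT).
Qed.

(** In the partition up to the later jump [v], slice [j] ends at [s j.+1], where the next slice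
    begins. The earlier jump [u] thus satisfies [v <= s j.+1 <= u]. *)
Lemma jump_times_uniq E t t' j : hybrid_time_domain E ->
  jump_times E (t, j) -> jump_times E (t', j) -> t = t'.
Proof.
move=> hE.
have main u v : u <= v -> jump_times E (u, j) -> jump_times E (v, j) -> u = v.
  move=> uv [/= Eu Eu1] [/= Ev Ev1].
  have [E0 _ /(_ v j.+1 Ev1)] := hE; move=> [J' [s [_ _ sE]]].
  have u0 : 0 <= u := E0 _ Eu.
  have box w i : E (w, i) -> 0 <= w <= v -> (i <= j.+1)%N -> s i <= w <= s i.+1.
    move=> Ew wv ij.
    have : (E `&` [set tj | 0 <= tj.1 <= v /\ (tj.2 <= j.+1)%N]) (w, i) by [].
    by rewrite sE => -[].
  have u0v : 0 <= u <= v by rewrite u0.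
  have v0v : 0 <= v <= v by rewrite lexx (le_trans u0).
  have /andP[_ h1] := box v j Ev v0v (leqnSn j).
  have /andP[h2 _] := box u j.+1 Eu1 u0v (leqnn _).
  by apply/le_anti; rewrite uv (le_trans h1).
move=> h h'; have [tt|/ltW tt] := leP t t'; first exact: main.
by apply/esym; exact: main.
Qed.

Lemma interior_time_slice E j u v t : (forall s, u <= s <= v -> E (s, j)) ->
  u < t < v -> interior (time_slice E j) t.
Proof.
move=> hE /andP[ut tv].
have : nbhs t `]u, v[%classic by apply: near_in_itvoo; rewrite in_itv/= ut.
apply: filterS => s /=; rewrite in_itv/= => /andP[us sv].
by apply: hE; rewrite !ltW.
Qed.

End HybridTimeDomains.

(** * Potential and Lyapunov function of the closed loop *)

Section ClosedLoop.
Context {R : realType} {n : nat}.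
Variables (p : 'I_n -> 'cV[R]_3) (k : 'I_n -> R) (kR kp kv : R) (g : 'cV[R]_3).
Variables (omega a : R -> 'cV[R]_3) (theta delta : R) (U : set 'cV[R]_3).
Hypothesis kc0 : k_c k != 0.
Hypothesis k_ge0 : forall i, 0 <= k i.
Hypothesis U1 : U `<=` @unit_sphere R.
Local Notation M := (M_c p k).
Local Notation H := (closed_loop p k kR kp kv g omega a theta U delta).

Definition rot_error (x : state R) : 'M[R]_3 := x.1.1.1.2.
Definition pos_error (x : state R) : 'cV[R]_3 := x.1.1.2.
Definition vel_error (x : state R) : 'cV[R]_3 := x.1.2.
Definition potential (x : state R) := \tr ((1%:M - rot_error x) *m M).

Definition lyapunov (eps gam : R) (x : state R) :=
  k_c k * kv * sqnorm (pos_error x) + sqnorm (vel_error x)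
  - 2 * eps * dot (pos_error x) (vel_error x)
  + gam * potential x.

Lemma rot_le x : `|rot_error x| <= `|x|.
Proof.
apply: le_trans (norm_fst_le x); apply: le_trans (norm_fst_le x.1).
by apply: le_trans (norm_fst_le x.1.1); exact: norm_snd_le.
Qed.

Lemma pos_le x : `|pos_error x| <= `|x|.
Proof.
apply: le_trans (norm_fst_le x); apply: le_trans (norm_fst_le x.1).
exact: norm_snd_le.
Qed.

Lemma vel_le x : `|vel_error x| <= `|x|.
Proof. by apply: le_trans (norm_fst_le x); exact: norm_snd_le. Qed.

Section Trajectory.
Variables (x : R -> nat -> state R) (j : nat).

Lemma ac_rot u v i l : absolutely_continuous u v (x^~ j) ->
  absolutely_continuous u v (fun s => rot_error (x s j) i l).
Proof.
apply: (@ac_linear_comp _ _ (fun y : state R => rot_error y i l) 1) => [c y z|y].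
  by rewrite /rot_error /= !mxE.
by rewrite mul1r (le_trans (mx_coord_le _ _ _))// rot_le.
Qed.

Lemma ac_pos u v i : absolutely_continuous u v (x^~ j) ->
  absolutely_continuous u v (fun s => pos_error (x s j) i 0).
Proof.
apply: (@ac_linear_comp _ _ (fun y : state R => pos_error y i 0) 1) => [c y z|y].
  by rewrite /pos_error /= !mxE.
by rewrite mul1r (le_trans (mx_coord_le _ _ _))// pos_le.
Qed.

Lemma ac_vel u v i : absolutely_continuous u v (x^~ j) ->
  absolutely_continuous u v (fun s => vel_error (x s j) i 0).
Proof.
apply: (@ac_linear_comp _ _ (fun y : state R => vel_error y i 0) 1) => [c y z|y].
  by rewrite /vel_error /= !mxE.
by rewrite mul1r (le_trans (mx_coord_le _ _ _))// vel_le.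
Qed.

(** The linear part of the affine [potential], to which the lemmas on linear images apply. *)
Definition rot_pairing (y : state R) := \tr (rot_error y *m M).

Lemma rot_pairing_linear c y z : rot_pairing (c *: (y - z)) = c * (rot_pairing y - rot_pairing z).
Proof.
rewrite /rot_pairing (_ : rot_error (c *: (y - z)) = c *: (rot_error y - rot_error z))//.
by rewrite -scalemxAl linearZ/= mulmxBl linearB.
Qed.

Lemma rot_pairing_le y : `|rot_pairing y| <= (\sum_i \sum_l `|M l i|) * `|y|.
Proof.
rewrite /rot_pairing /mxtrace (le_trans (ler_norm_sum _ _ _))// mulr_suml ler_sum// => i _.
rewrite mxE (le_trans (ler_norm_sum _ _ _))// mulr_suml ler_sum// => l _.
rewrite normrM mulrC ler_wpM2l// (le_trans (mx_coord_le _ _ _))//.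
exact: rot_le.
Qed.

Lemma potentialE y : potential y = \tr M - rot_pairing y.
Proof. by rewrite /potential mulmxBl mul1mx linearB. Qed.

Lemma ac_pot u v : absolutely_continuous u v (x^~ j) ->
  absolutely_continuous u v (fun s => potential (x s j)).
Proof.
move=> acx; rewrite (_ : (fun s => _) = (fun s => \tr M + (-1) * rot_pairing (x s j))).
  apply: acD; first exact: (@ac_cst _ R^o).
  apply: acM; first exact: (@ac_cst _ R^o).
  exact: ac_linear_comp rot_pairing_linear rot_pairing_le acx.
by apply/funext => s; rewrite potentialE mulN1r.
Qed.

Lemma is_derive_pot (t : R) dx : is_derive t 1 (x^~ j) dx ->
  is_derive t 1 (fun s => potential (x s j)) (- rot_pairing dx).
Proof.
move=> Dx; have D := is_derive_linear_comp rot_pairing_linear rot_pairing_le Dx.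
have := is_deriveB (is_derive_cst (\tr M : R^o) t 1) D.
rewrite (_ : (fun s => potential _) = (cst (\tr M) - (fun s => rot_pairing (x s j)))).
  by move=> /is_derive_eq; apply; rewrite sub0r.
by apply/funext => s; rewrite potentialE.
Qed.

Lemma is_derive_pos (t : R) dx i : is_derive t 1 (x^~ j) dx ->
  is_derive t 1 (fun s => pos_error (x s j) i 0) (pos_error dx i 0).
Proof.
apply: (@is_derive_linear_comp _ _ (fun y : state R => pos_error y i 0) 1) => [c y z|y].
  by rewrite /pos_error /= !mxE.
by rewrite mul1r (le_trans (mx_coord_le _ _ _))// pos_le.
Qed.

Lemma is_derive_vel (t : R) dx i : is_derive t 1 (x^~ j) dx ->
  is_derive t 1 (fun s => vel_error (x s j) i 0) (vel_error dx i 0).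
Proof.
apply: (@is_derive_linear_comp _ _ (fun y : state R => vel_error y i 0) 1) => [c y z|y].
  by rewrite /vel_error /= !mxE.
by rewrite mul1r (le_trans (mx_coord_le _ _ _))// vel_le.
Qed.

Lemma ac_lyapunov u v eps gam : absolutely_continuous u v (x^~ j) ->
  absolutely_continuous u v (fun s => lyapunov eps gam (x s j)).
Proof.
move=> acx; have cst c : absolutely_continuous u v (fun=> c : R) by exact: (@ac_cst _ R^o).
have acp i := ac_pos i acx; have acv i := ac_vel i acx.
rewrite (_ : (fun s => _) = (fun s => k_c k * kv * sqnorm (pos_error (x s j))
   + sqnorm (vel_error (x s j)) + (- (2 * eps)) * dot (pos_error (x s j)) (vel_error (x s j))
   + gam * potential (x s j))); last first.
  by apply/funext => s; rewrite /lyapunov; ring.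
apply: acD; [apply: acD; [apply: acD|]|].
- by apply: acM => //; exact: ac_dot.
- exact: ac_dot.
- by apply: acM => //; exact: ac_dot.
- by apply: acM => //; exact: ac_pot.
Qed.

Lemma is_derive_lyapunov (t : R) dx eps gam : is_derive t 1 (x^~ j) dx ->
  is_derive t 1 (fun s => lyapunov eps gam (x s j))
   (2 * (k_c k * kv) * dot (pos_error (x t j)) (pos_error dx)
    + 2 * dot (vel_error (x t j)) (vel_error dx)
    - 2 * eps * (dot (pos_error dx) (vel_error (x t j)) + dot (pos_error (x t j)) (vel_error dx))
    + gam * - rot_pairing dx).
Proof.
move=> Dx; have Dp i := is_derive_pos i Dx; have Dv i := is_derive_vel i Dx.
have Dpp := is_derive_dot Dp Dp; have Dvv := is_derive_dot Dv Dv.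
have Dpv := is_derive_dot Dp Dv; have DV := is_derive_pot Dx.
have := is_deriveD (is_deriveD (is_deriveD (is_deriveZ (k_c k * kv) Dpp) Dvv)
  (is_deriveZ (- (2 * eps)) Dpv)) (is_deriveZ gam DV).
rewrite (_ : (fun s => lyapunov _ _ _) =
   (k_c k * kv) *: (fun s => dot (pos_error (x s j)) (pos_error (x s j)))
   + (fun s => dot (vel_error (x s j)) (vel_error (x s j)))
   + (- (2 * eps)) *: (fun s => dot (pos_error (x s j)) (vel_error (x s j)))
   + gam *: (fun s => potential (x s j))).
  move=> /is_derive_eq; apply; rewrite /GRing.scale/= (dotC (pos_error dx) (pos_error _)).
  by rewrite (dotC (vel_error dx) (vel_error _)); ring.
by apply/funext => s; rewrite /lyapunov /sqnorm !fctE /GRing.scale/=; ring.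
Qed.

End Trajectory.

(** * Estimates along one solution, for given constants *)

Section Stability.
Variables (m1 m2 c eps gam lam q1 q2 : R).
Hypothesis c_ge0 : 0 <= c.
Hypothesis kR_gt0 : 0 < kR.
Hypothesis delta_gt0 : 0 < delta.
Hypothesis m1_ge0 : 0 <= m1.
Hypothesis m2_ge0 : 0 <= m2.
Hypothesis gam_ge0 : 0 <= gam.
Hypothesis lam_ge0 : 0 <= lam.
Hypothesis bounds : forall Q, SO3 Q ->
  m1 * sqnorm_rot Q <= \tr ((1%:M - Q) *m M) <= m2 * sqnorm_rot Q.
Hypothesis dissipation : forall Q, SO3 Q ->
  (forall u, U u ->
     \tr ((1%:M - Q) *m M) - \tr ((1%:M - Q *m angle_axis theta u) *m M) <= delta) ->
  c * sqnorm_rot Q <= - \tr (skew_part (M *m Q) *m (M *m Q)).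
Hypothesis lyapunovP : forall (x y d : 'cV[R]_3) (r V V' : R), 0 <= r ->
  sqnorm d <= 4 * sqnorm g * r -> m1 * r <= V <= m2 * r -> V' <= - (kR * c) * r ->
  let L := k_c k * kv * sqnorm x + sqnorm y - 2 * eps * dot x y + gam * V in
  [/\ q1 * (r + sqnorm x + sqnorm y) <= L,
      L <= q2 * (r + sqnorm x + sqnorm y) &
      2 * (k_c k * kv) * dot x (- (k_c k * kp) *: x + y) + 2 * dot y (- (k_c k * kv) *: x + d)
      - 2 * eps * (dot (- (k_c k * kp) *: x + y) y + dot x (- (k_c k * kv) *: x + d))
      + gam * V' <= - lam * L].

Variables (E : set (R * nat)) (x : R -> nat -> state R).
Hypothesis solx : solution H E x.

Lemma flow_map_rot_pairing y : rot_pairing (flow_map H y) =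
  kR * \tr (skew_part (M *m rot_error y) *m (M *m rot_error y)) * -1.
Proof.
case: y => [[[[Xh Rt] pe] vt] t]; rewrite /rot_pairing /rot_error /=.
rewrite -scalemxAr -scalemxAl linearZ/= mulNr mulrN1; congr (- (_ * _)).
by rewrite mxtrace_mulC mulmxA mxtrace_mulC.
Qed.

(** In the flow set no axis of [U] lowers the potential by more than [delta], so the dissipation
    bound applies; the Lyapunov inequality is then used with input [d = (I - Q) g]. *)
Lemma flow_estimate y : flow_set H y ->
  [/\ SO3 (rot_error y), - rot_pairing (flow_map H y) <= - (kR * c) * sqnorm_rot (rot_error y) &
   2 * (k_c k * kv) * dot (pos_error y) (pos_error (flow_map H y))
    + 2 * dot (vel_error y) (vel_error (flow_map H y))
    - 2 * eps * (dot (pos_error (flow_map H y)) (vel_error y)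
                 + dot (pos_error y) (vel_error (flow_map H y)))
    + gam * - rot_pairing (flow_map H y) <= - lam * lyapunov eps gam y].
Proof.
move=> [Sy muy].
have SR : SO3 (rot_error y) by case: y Sy {muy} => [[[[Xh Rt] pe] vt] t] [].
have V' : - rot_pairing (flow_map H y) <= - (kR * c) * sqnorm_rot (rot_error y).
  rewrite flow_map_rot_pairing mulrN1 opprK mulNr lerNr -mulrN -mulrA ler_wpM2l ?(ltW kR_gt0)//.
  apply: dissipation => // u Uu.
  case: y Sy muy SR => [[[[Xh Rt] pe] vt] t] [SX _ _] muy SR.
  exact: (flow_potential_drop kc0 U1 k_ge0 SX SR Uu muy).
split => //.
have r0 := sqnorm_rot_ge0 SR.
have [_ _] := lyapunovP (pos_error y) (vel_error y) r0
  (sqnorm_sub1_rot g SR) (bounds SR) V'.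
by case: y {Sy muy SR V' r0} => [[[[Xh Rt] pe] vt] t].
Qed.

(** Gronwall's lemma is applied off the null set where the differential equation fails. Membership
    in SO(3) at the ends is a limit from the open interval, hence the condition [u < v]. *)
Lemma flow_step j u v : u <= v -> (forall t, u <= t <= v -> E (t, j)) ->
  [/\ lyapunov eps gam (x v j) <= expR (- lam * (v - u)) * lyapunov eps gam (x u j),
      potential (x v j) <= potential (x u j) &
      u < v -> SO3 (rot_error (x u j)) /\ SO3 (rot_error (x v j))].
Proof.
move=> uv hE; have [[_ acx] _ flowx derx _] := solx.
have acu : absolutely_continuous u v (x^~ j).
  by apply: acx => // t /=; rewrite in_itv/=; exact: hE.
pose N := ~` [set t : R | interior (time_slice E j) t ->
   is_derive (t : R) 1 (x^~ j) (flow_map H (x t j))].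
have N0 : (@lebesgue_measure R).-negligible N by exact: derx.
have int t : u < t < v -> interior (time_slice E j) t by exact: interior_time_slice.
have Dx (t : R) : u < t < v -> ~ N t -> is_derive (t : R) 1 (x^~ j) (flow_map H (x t j)).
  by move=> tuv /contrapT; apply; exact: int.
have Fx t : u < t < v -> flow_set H (x t j) by move=> /int; exact: flowx.
split.
- apply: (ac_gronwall uv lam_ge0 (ac_lyapunov _ _ acu) N0) => t tuv Nt.
  have [_ _ h] := flow_estimate (Fx t tuv).
  by eexists; first exact: is_derive_lyapunov (Dx t tuv Nt).
(* The rate 0 turns Gronwall's lemma into monotonicity. *)
- have := ac_gronwall uv (lexx 0) (ac_pot acu) N0.
  rewrite oppr0 mul0r expR0 mul1r; apply => t tuv Nt.
  have [SR h _] := flow_estimate (Fx t tuv).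
  eexists; first exact: is_derive_pot (Dx t tuv Nt).
  rewrite mul0r (le_trans h)// mulNr oppr_le0; apply: mulr_ge0 (sqnorm_rot_ge0 SR).
  exact: mulr_ge0 (ltW kR_gt0) c_ge0.
- move=> ltuv.
  have acr i l := ac_rot i l acu.
  have SO3x t : u < t < v -> SO3 (rot_error (x t j)).
    by move=> /Fx /flow_estimate[].
  have orth i l : (rot_error (x u j) *m (rot_error (x u j))^T) i l = (i == l)%:R /\
      (rot_error (x v j) *m (rot_error (x v j))^T) i l = (i == l)%:R.
    apply: (ac_cst_closed ltuv
      (f := fun t => (rot_error (x t j) *m (rot_error (x t j))^T) i l)).
      rewrite (_ : (fun t => _) =
          (fun t => \sum_m rot_error (x t j) i m * rot_error (x t j) l m)).
        by apply: ac_sum => m; exact: acM.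
      by apply/funext => t; rewrite mxE; apply: eq_bigr => m _; rewrite mxE.
    by move=> t /SO3x [-> _]; rewrite mxE.
  have deter : \det (rot_error (x u j)) = 1 /\ \det (rot_error (x v j)) = 1.
    apply: (ac_cst_closed ltuv (f := fun t => \det (rot_error (x t j)))); last first.
      by move=> t /SO3x [].
    under eq_fun do rewrite det3E.
    have acN f : absolutely_continuous u v f -> absolutely_continuous u v (fun t => - f t : R).
      move=> acf; under eq_fun do rewrite -mulN1r.
      exact: (acM (@ac_cst _ R^o u v (-1)) acf).
    have ac2 i l i' l' := acM (acr i l) (acr i' l').
    have minor i l i' l' i1 l1 i2 l2 := acD (ac2 i l i' l') (acN _ (ac2 i1 l1 i2 l2)).
    exact: (acD (acD (acM (acr _ _) (minor _ _ _ _ _ _ _ _))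
      (acN _ (acM (acr _ _) (minor _ _ _ _ _ _ _ _))))
      (acM (acr _ _) (minor _ _ _ _ _ _ _ _))).
  split; split; try (by case: deter); apply/matrixP => i l; rewrite [RHS]mxE.
    by case: (orth i l).
  by case: (orth i l).
Qed.

(** Jumps leave the position and velocity errors unchanged, so the Lyapunov function varies only
    through the potential. *)
Lemma jump_step t j : E (t, j) -> E (t, j.+1) ->
  [/\ SO3 (rot_error (x t j)), SO3 (rot_error (x t j.+1)),
      potential (x t j.+1) <= potential (x t j) - delta &
      lyapunov eps gam (x t j.+1) <= lyapunov eps gam (x t j)].
Proof.
move=> Etj Etj1; have [_ _ _ _ /(_ t j Etj Etj1)[[]]] := solx.
case: (x t j) => [[[[Xh Rt] pe] vt] s] [SX SR _] muh [Rq [vq [pq [mq ->]]]].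
have [SRq drop] := jump_potential_drop kc0 U1 SX SR mq muh.
split => //; first exact: SO3_mul.
rewrite /lyapunov /potential /pos_error /vel_error /rot_error /= lerD2l ler_wpM2l//.
by rewrite (le_trans drop)// gerBl ltW.
Qed.

(** Induction on the jumps. Flows give decay in [T]; each jump takes [delta] from the potential, and
    flows never give it back. *)
Lemma trajectory_estimate T J : E (T, J) ->
  lyapunov eps gam (x T J) <= expR (- lam * T) * lyapunov eps gam (x 0 0%N) /\
  potential (x T J) + delta * J%:R <= potential (x 0 0%N).
Proof.
move=> ETJ; have [[htd _] _ _ _ _] := solx.
have [s [s0 sE sJ Ei EJ]] := hybrid_time_domain_jumps htd ETJ.
have ind i : (i <= J)%N ->
    lyapunov eps gam (x (s i) i) <= expR (- lam * s i) * lyapunov eps gam (x 0 0%N) /\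
    potential (x (s i) i) + delta * i%:R <= potential (x 0 0%N).
  elim: i => [_|i IH iJ]; first by rewrite s0 !mulr0 expR0 mul1r addr0.
  have [IH1 IH2] := IH (ltnW iJ).
  have [ss Es] := sE i iJ.
  have [f1 f2 _] := flow_step ss (fun t => Ei i t iJ).
  have Esi : E (s i.+1, i) by apply: Ei => //; rewrite lexx ss.
  have [_ _ j1 j2] := jump_step Esi Es.
  split; last by rewrite -natr1 mulrDr mulr1; lra.
  apply: (le_trans j2); apply: (le_trans f1).
  have -> : expR (- lam * s i.+1) = expR (- lam * (s i.+1 - s i)) * expR (- lam * s i).
    by rewrite -expRD; congr expR; ring.
  by rewrite -mulrA ler_wpM2l// expR_ge0.
have [h1 h2] := ind J (leqnn J).
have [f1 f2 _] := flow_step sJ EJ.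
split; last by lra.
apply: (le_trans f1).
have -> : expR (- lam * T) = expR (- lam * (T - s J)) * expR (- lam * s J).
  by rewrite -expRD; congr expR; ring.
by rewrite -mulrA ler_wpM2l// expR_ge0.
Qed.

(** Any point other than [(0, 0)] is reached through a jump or a nondegenerate flow, and both give
    membership at their ends. The initial point alone is set apart, since the decay estimate is
    trivial there. *)
Lemma trajectory_SO3 T J : E (T, J) -> (T, J) = (0, 0%N) \/
  SO3 (rot_error (x 0 0%N)) /\ SO3 (rot_error (x T J)).
Proof.
move=> ETJ; have [[htd _] _ _ _ _] := solx.
have [s [s0 sE sJ Ei EJ]] := hybrid_time_domain_jumps htd ETJ.
case: J ETJ sE sJ Ei EJ => [|J] ETJ sE sJ Ei EJ.
  have [T0|T0] := eqVneq T 0; first by left; rewrite T0.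
  right; rewrite s0 in sJ EJ.
  have [_ _] := flow_step sJ EJ; apply.
  by rewrite lt_neqAle eq_sym T0.
right; split.
  have [s1 E1] := sE 0%N isT; rewrite s0 in s1.
  have Es1 : E (s 1%N, 0%N) by apply: Ei => //; rewrite s0 s1 lexx.
  have [s10|s10] := eqVneq (s 1%N) 0.
    by rewrite s10 in E1 Es1; have [] := jump_step Es1 E1.
  have E01 t : 0 <= t <= s 1%N -> E (t, 0%N) by move=> h; apply: Ei => //; rewrite s0.
  have [_ _ []//] := flow_step s1 E01.
  by rewrite lt_neqAle eq_sym s10.
have [sJT|sJT] := eqVneq (s J.+1) T.
  have [ss Es] := sE J (leqnn _); rewrite -sJT.
  have Esi : E (s J.+1, J) by apply: Ei => //; rewrite lexx ss.
  by have [] := jump_step Esi Es.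
have [_ _ []//] := flow_step sJ EJ.
by rewrite lt_neqAle sJT.
Qed.

(** The potential starts at [m2] at most, stays nonnegative and loses [delta] at every jump. *)
Lemma jump_count_bound T J : E (T, J.+1) -> delta * J.+1%:R <= m2.
Proof.
move=> ETJ; have [[_ //]|[S0 SJ]] := trajectory_SO3 ETJ.
have [_ h] := trajectory_estimate ETJ.
have /andP[_ h0] := bounds S0; have /andP[hJ _] := bounds SJ.
have rJ := mulr_ge0 m1_ge0 (sqnorm_rot_ge0 SJ).
have r1 := ler_wpM2l m2_ge0 (sqnorm_rot_le1 S0).
rewrite /potential in h; lra.
Qed.

Lemma finite_jump_times : finite_set (jump_times E).
Proof.
have [[htd _] _ _ _ _] := solx.
have N0 : 0 <= m2 / delta by rewrite divr_ge0 // ltW.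
pose N := Num.bound (m2 / delta).
(* [tau j] is the time of the jump out of slice [j], with default 0 when there is none; uniqueness
   makes the jump times an image of finitely many [j]. *)
pose tau j := xget 0 [set t | jump_times E (t, j)].
apply: (@sub_finite_set _ _ ((fun j => (tau j, j)) @` `I_N)); last first.
  by apply: finite_image; exact: finite_II.
move=> [t j] Etj; have [/= _ Etj1] := Etj.
exists j => /=.
  have := jump_count_bound Etj1; rewrite mulrC -ler_pdivlMr// => jm.
  have := le_lt_trans jm (archi_boundP N0); rewrite ltr_nat; exact: ltn_trans.
congr (_, _); apply: (jump_times_uniq htd _ Etj).
exact: (@xgetI _ 0 [set u | jump_times E (u, j)] t Etj).
Qed.

Lemma lyapunov_dist y : SO3 (rot_error y) ->
  q1 * dist_A_1 y ^+ 2 <= lyapunov eps gam y <= q2 * dist_A_1 y ^+ 2.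
Proof.
move=> SR; have r0 := sqnorm_rot_ge0 SR.
have -> : dist_A_1 y ^+ 2 =
    sqnorm_rot (rot_error y) + sqnorm (pos_error y) + sqnorm (vel_error y).
  case: y SR r0 => [[[[Xh Rt] pe] vt] t] SR r0.
  by rewrite /dist_A_1 sqr_sqrtr// !addr_ge0// sqnorm_ge0.
(* The two bounds on [L] involve neither [d] nor [V'], so any admissible values will do: [d = 0],
   and [V'] equal to its upper bound. *)
have d0 : sqnorm (0 : 'cV[R]_3) <= 4 * sqnorm g * sqnorm_rot (rot_error y).
  rewrite {1}/sqnorm /dot mulmx0 mxE; apply: mulr_ge0 r0.
  by rewrite mulr_ge0 ?sqnorm_ge0.
have [h1 h2 _] := lyapunovP (pos_error y) (vel_error y) r0 d0 (bounds SR) (lexx _).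
by rewrite /lyapunov h1 h2.
Qed.

(** The ratio [q2 / q1] compares the Lyapunov function with the squared distance. Since
    [J <= m2 / delta], the factor [expR (lam * (m2 / delta))] pays for replacing [T] by [T + J]; the
    square root halves the rate. *)
Lemma dist_estimate T J : 0 < q1 -> 0 < q2 -> E (T, J) ->
  dist_A_1 (x T J) <=
    (1 + Num.sqrt (q2 / q1 * expR (lam * (m2 / delta)))) * expR (- (lam / 2) * (T + J%:R))
    * dist_A_1 (x 0 0%N).
Proof.
move=> q10 q20 ETJ.
have dist0 y : 0 <= dist_A_1 y by case: y => [[[[Xh Rt] pe] vt] t]; exact: sqrtr_ge0.
(* At the initial point the summand 1 of the constant suffices. *)
have [[-> ->]|[S0 ST]] := trajectory_SO3 ETJ.
  by rewrite addr0 mulr0 expR0 mulr1 mulrDl mul1r lerDl mulr_ge0 ?sqrtr_ge0 ?dist0.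
have [hL _] := trajectory_estimate ETJ.
have /andP[hT _] := lyapunov_dist ST; have /andP[_ h0] := lyapunov_dist S0.
have Jb : J%:R <= m2 / delta.
  case: J ETJ {ST hL hT} => [|J] ETJ; first by rewrite divr_ge0// ltW.
  by rewrite ler_pdivlMr// mulrC (jump_count_bound ETJ).
set K := q2 / q1 * _; set r := lam / 2.
have K0 : 0 <= K by rewrite mulr_ge0 ?expR_ge0// divr_ge0// ltW.
have sq : dist_A_1 (x T J) ^+ 2 <=
    (Num.sqrt K * expR (- r * (T + J%:R)) * dist_A_1 (x 0 0%N)) ^+ 2.
  rewrite !exprMn sqr_sqrtr// -expRM_natl mulr_natl.
  have -> : (- r * (T + J%:R)) *+ 2 = - lam * (T + J%:R) by rewrite mulr2n /r; field.
  rewrite -(ler_pM2l q10); apply: (le_trans hT); apply: (le_trans hL).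
  apply: (@le_trans _ _ (expR (- lam * T) * (q2 * dist_A_1 (x 0 0%N) ^+ 2))).
    by rewrite ler_wpM2l ?expR_ge0.
  have -> : q1 * (K * expR (- lam * (T + J%:R)) * dist_A_1 (x 0 0%N) ^+ 2) =
     expR (lam * (m2 / delta)) * expR (- lam * (T + J%:R)) * (q2 * dist_A_1 (x 0 0%N) ^+ 2).
    by rewrite /K; field; rewrite gt_eqF.
  apply: ler_wpM2r; first exact: mulr_ge0 (ltW q20) (sqr_ge0 _).
  rewrite -expRD ler_expR.
  have := ler_wpM2l lam_ge0 Jb; lra.
have : dist_A_1 (x T J) <= Num.sqrt K * expR (- r * (T + J%:R)) * dist_A_1 (x 0 0%N).
  rewrite -(@ler_pXn2r _ 2) ?nnegrE ?dist0//.
  by rewrite !mulr_ge0 ?dist0 ?sqrtr_ge0 ?expR_ge0.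
move=> /le_trans; apply.
apply: ler_wpM2r; first exact: dist0.
apply: ler_wpM2r; first exact: expR_ge0.
by rewrite lerDr.
Qed.

End Stability.
End ClosedLoop.

Theorem theorem1 (R : realType) (n : nat) (p : 'I_n -> 'cV[R]_3)
    (k : 'I_n -> R) (kR kp kv : R) (g : 'cV[R]_3) (omega a : R -> 'cV[R]_3)
    (theta delta : R) (U : set 'cV[R]_3)
    (n_ge3 : (3 <= n)%N)
    (noncollinear : exists i j l : 'I_n,
       ~ collinear [set x | [\/ x = p i, x = p j | x = p l]])
    (k_gt0 : forall i, 0 < k i)
    (kR_gt0 : 0 < kR) (kp_gt0 : 0 < kp) (kv_gt0 : 0 < kv)
    (omega_cont : {within `[0, +oo[%classic, continuous omega})
    (a_cont : {within `[0, +oo[%classic, continuous a})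
    (theta_gt0 : 0 < theta) (theta_le_pi : theta <= pi)
    (U_admissible : admissible_axes (M_c p k) U)
    (delta_gt0 : 0 < delta)
    (delta_lt : delta < (1 - cos theta) * gap (M_c p k) U) :
  (forall (E : set (R * nat)) (x : R -> nat -> state R),
     solution (closed_loop p k kR kp kv g omega a theta U delta) E x ->
     finite_set (jump_times E)) /\
  uniformly_globally_exponentially_stable
    (closed_loop p k kR kp kv g omega a theta U delta)
    (@A_1 R) (@dist_A_1 R).
Proof.
have kc_gt0 : 0 < k_c k.
  rewrite /k_c; have i0 : 'I_n := Ordinal (leq_trans (isT : (0 < 3)%N) n_ge3).
  rewrite (bigD1 i0)//= ltr_wpDr// sumr_ge0// => i _; exact: ltW.
have k_ge0 i : 0 <= k i by exact: ltW.
have [_ U1 axes] := U_admissible.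
(* Either choice of axes contains an orthonormal family, of which [e 0] is a member. *)
have U0 : U !=set0.
  by case: axes => [[_ [e [_ _ Ue]]]|[_ [e [_ Ue]]]]; exists (e 0); exact: Ue.
have MT := M_c_sym p k.
have M_gt0 v : v != 0 -> 0 < \tr (M_c p k) * sqnorm v - dot v (M_c p k *m v).
  exact: quad_M_c_gt0.
have M_ge0 v : 0 <= dot v (M_c p k *m v).
  by rewrite dot_M_c sumr_ge0// => i _; rewrite mulr_ge0// sqr_ge0.
have [m1 [m2 [m10 m20 bounds]]] := SO3_potential_bounds MT M_gt0 M_ge0.
have [c c0 dissipation] := flow_dissipation MT M_gt0 M_ge0 U1 U0 delta_gt0 delta_lt.
(* Here [a] and [b] are the gains [k_c kp] and [k_c kv] of the translational errors, [kR * c] is the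
   dissipation of the potential relative to [|Q|_I^2], and [4 |g|^2] bounds the input. *)
have [eps [gam [lam [q1 [q2 [gam0 lam0 q10 q20 lyap]]]]]] :=
  lyapunov_constants (mulr_gt0 kc_gt0 kp_gt0) (mulr_gt0 kc_gt0 kv_gt0)
    (mulr_gt0 kR_gt0 c0) (mulr_ge0 (ler0n R 4) (sqnorm_ge0 g)) m10 m20.
split.
  move=> E x solx.
  exact: (finite_jump_times (lt0r_neq0 kc_gt0) k_ge0 U1 (ltW c0) kR_gt0 delta_gt0 (ltW m10)
    (ltW m20) gam0 (ltW lam0) bounds dissipation lyap solx).
split; first by move=> x [] [Sx _]; exact: dist_A_1_eq0.
exists (1 + Num.sqrt (q2 / q1 * expR (lam * (m2 / delta)))), (lam / 2); split.
- by rewrite ltr_pwDl// sqrtr_ge0.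
- by rewrite divr_gt0.
- move=> E x solx t j Etj.
  exact: (dist_estimate (lt0r_neq0 kc_gt0) k_ge0 U1 (ltW c0) kR_gt0 delta_gt0 (ltW m10)
    (ltW m20) gam0 (ltW lam0) bounds dissipation lyap solx q10 q20 Etj).
Qed.
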